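(* Let $\gamma$ be the standard one-dimensional Gaussian measure $N(0,1)$ on $\mathbb{R}$, let $\gamma^\infty$ be the product measure on $\mathbb{R}^\infty$ (the product of countably many copies of $(\mathbb{R},\gamma)$), and let the full orthogonal group $O(l_2)$ of the real Hilbert space $l_2$ (with the strong operator topology) near-act on $(\mathbb{R}^\infty,\gamma^\infty)$ by the near-action induced from its action on measurable linear functionals. Then this near-action (the automorphism group of the Gaussian measure) admits no spatial model.
   Context: Near-action: for a Polish group $G$ and a standard Borel space with a probability measure $(X,\mathcal{X},\mu)$, a near-action is a Borel map $G\times X\to X$, $(g,x)\mapsto gx$, such that (i) $ex=x$ for almost every $x$; (ii) for each pair $g,h\in G$, $g(hx)=(gh)x$ for almost every $x$ (the null set may depend on $g,h$); (iii) each $g\in G$ preserves $\mu$. Equivalently (identifying near-actions that agree a.e. for each $g$), it is a continuous homomorphism from $G$ to the Polish group $\mathrm{Aut}(X,\mathcal{X},\mu)$ of equivalence classes mod 0 of invertible measure preserving transformations, with neighborhood basis at the identity given by the sets $\{T:\mu(A\triangle TA)<\varepsilon\}$, $A\in\mathcal{X}$, $\varepsilon>0$ (and their finite intersections). The Gaussian near-action: let $\zeta_1,\zeta_2,\dots$ be the coordinate functions on $\mathbb{R}^\infty$; they are i.i.d. $N(0,1)$ under $\gamma^\infty$. For $c=(c_1,c_2,\dots)\in l_2$ put $\zeta(c)=\sum_k c_k\zeta_k\in L^2(\gamma^\infty)$. The near-action of $O(l_2)$ is determined by the requirement that $\zeta(gc)=\zeta(c)\circ g^{-1}$ almost everywhere,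 for all $c\in l_2$ and $g\in O(l_2)$. Spatial model: a spatial $G$-action is a Borel map $G\times Y\to Y$ on a standard Borel probability space $(Y,\mathcal{Y},\nu)$ with $ey=y$ and $g(hy)=(gh)y$ for all $g,h\in G$ and all $y\in Y$, such that each $g$ preserves $\nu$. A spatial model of a near-action on $(X,\mathcal{X},\mu)$ is a spatial action on some $(Y,\mathcal{Y},\nu)$ that, viewed as a near-action, is isomorphic to the given one: there is an invertible mod 0 measure preserving map $\varphi:X\to Y$ such that for each $g\in G$, $\varphi(gx)=g\varphi(x)$ for almost every $x$ (the null set may depend on $g$). *)

(* Defs.v *)
From HB Require Import structures.
From mathcomp Require Import all_boot all_order all_algebra finmap.
From mathcomp Require Import all_classical all_reals all_analysis.

Set Implicit Arguments.
Unset Strict Implicit.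
Unset Printing Implicit Defensive.

Import Order.TTheory GRing.Theory Num.Theory.
Import numFieldNormedType.Exports.

Local Open Scope classical_set_scope.
Local Open Scope ring_scope.

HB.mixin Record PointedTopological_isTopologicalGroup G
    & PointedTopological G & Group G := {
  mulg_continuous : continuous (fun p : G * G => (p.1 * p.2)%g) ;
  invg_continuous : continuous (fun g : G => (g^-1)%g) }.

#[short(type="topGroupType")]
HB.structure Definition TopologicalGroup :=
  {G of PointedTopological G & Group G
      & PointedTopological_isTopologicalGroup G}.

Definition borel (T : ptopologicalType) := g_sigma_algebraType (@open T).

(* Y is Borel isomorphic to a Polish space P. *)
Definition standard_borel (R : realType) d (Y : measurableType d) : Prop :=
  exists (P : completePseudoMetricType R) (f : Y -> P),
    [/\ hausdorff_space P,
        exists2 D : set P, countable D & dense D,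
        bijective f &
        forall A : set Y,
          measurable A <-> exists2 B, <<s open >> B & A = f @^-1` B].

Definition preserves (R : realType) d (X : measurableType d)
    (mu : probability X R) (T : X -> X) : Prop :=
  forall A, measurable A -> mu (T @^-1` A) = mu A.

(* Joint measurability is with respect to the product of the Borel
   sigma-algebra of G and the sigma-algebra of X: for X standard Borel and G
   Polish (the case of interest) this is the Borel sigma-algebra of G * X. *)
Definition near_action (R : realType) (G : topGroupType) d
    (X : measurableType d) (mu : probability X R) (a : G -> X -> X) : Prop :=
  [/\ measurable_fun [set: borel G * X] (fun p => a p.1 p.2),
      {ae mu, forall x, a 1%g x = x},
      forall g h : G, {ae mu, forall x, a g (a h x) = a (g * h)%g x} &
      forall g : G, preserves mu (a g)].

Definition spatial_action (R : realType) (G : topGroupType) d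
    (Y : measurableType d) (nu : probability Y R) (b : G -> Y -> Y) : Prop :=
  [/\ standard_borel R Y,
      measurable_fun [set: borel G * Y] (fun p => b p.1 p.2),
      forall y, b 1%g y = y,
      forall (g h : G) y, b g (b h y) = b (g * h)%g y &
      forall g : G, preserves nu (b g)].

Definition isomorphic_mod0 (R : realType) d (X : measurableType d)
    (mu : probability X R) d' (Y : measurableType d') (nu : probability Y R)
    (phi : X -> Y) : Prop :=
  [/\ measurable_fun [set: X] phi,
      forall B, measurable B -> mu (phi @^-1` B) = nu B &
      exists psi : Y -> X,
        [/\ measurable_fun [set: Y] psi,
            {ae mu, forall x, psi (phi x) = x} &
            {ae nu, forall y, phi (psi y) = y}]].

Definition has_spatial_model (R : realType) (G : topGroupType) d
    (X : measurableType d) (mu : probability X R) (a : G -> X -> X) : Prop :=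
  exists d' (Y : measurableType d') (nu : probability Y R) (b : G -> Y -> Y),
    spatial_action nu b /\
    exists phi : X -> Y, isomorphic_mod0 mu nu phi /\
      forall g : G, {ae mu, forall x, phi (a g x) = b g (phi x)}.

(* With respect to the counting measure on nat, square-integrable functions are
   the square-summable sequences, and equality a.e. is equality. *)
Definition l2 (R : realType) : Type :=
  LfunType (@counting nat R) (lee1n 2).

HB.instance Definition _ (R : realType) := GRing.Lmodule.on (l2 R).

Section l2_norm.
Variable R : realType.
Implicit Types c d : l2 R.

Let nrm c : R := fine ('N[@counting nat R]_2%:E[EFin \o c])%E.

Let nrmD c d : nrm (c + d) <= nrm c + nrm d.
Proof. exact: ler_LnormD. Qed.

Let nrmZ a c : nrm (a *: c) = `|a| * nrm c.
Proof.
by apply: EFin_inj; rewrite EFinM (finite_norm_fine (a *: c)) finite_norm_fine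
  -LnormZ.
Qed.

Let nrm0_eq0 c : nrm c = 0 -> c = 0.
Proof.
move=> /fine_Lnormr_eq0[A [_ A0 sA]]; apply/LfuneqP => k.
apply: contrapT => ck; have Ak : A k by apply: sA => /(_ I).
have : (counting [set k] <= @counting nat R A)%E.
  by apply: le_measure; rewrite ?inE// => _ ->.
by rewrite A0 /counting asboolT// fset_set1 cardfs1 lee_fin ler10.
Qed.

HB.instance Definition _ :=
  Lmodule_isNormed.Build R (l2 R) nrmD nrmZ nrm0_eq0.

Definition l2dot c d : R := limn (series (fun k => c k * d k)).

Lemma cvg_l2norm_sqr c :
  series (fun k => c k * c k) @ \oo --> `|c| ^+ 2.
Proof.
have h : (\sum_(k <oo) (c k * c k)%:E)%E = (`|c| ^+ 2)%:E :> \bar R.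
  transitivity ((`|c|%:E) `^ 2)%E; last first.
    by rewrite poweR_EFin powR_mulrn.
  rewrite (finite_norm_fine c) poweR_Lnorm ?pnatr_eq0//.
  rewrite ge0_integral_count; last by move=> k; exact: poweR_ge0.
  apply: eq_eseriesr => k _.
  by rewrite abse_EFin poweR_EFin powR_mulrn// real_normK ?num_real// expr2.
have /fine_cvg : (fun n => \sum_(0 <= k < n) (c k * c k)%:E)%E @ \oo -->
    (`|c| ^+ 2)%:E.
  rewrite -h; apply: is_cvg_nneseries => k _ _.
  by rewrite lee_fin -expr2 sqr_ge0.
by apply: cvg_trans; apply: near_eq_cvg; apply: nearW => n /=; rewrite sumEFin.
Qed.

Lemma l2dotxx c : l2dot c c = `|c| ^+ 2.
Proof. exact/cvg_lim/cvg_l2norm_sqr. Qed.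

End l2_norm.

Record Ol2 (R : realType) := OrthogonalOperator {
  Ol2_fun :> l2 R -> l2 R ;
  Ol2_linear : linear Ol2_fun ;
  Ol2_bij : bijective Ol2_fun ;
  Ol2_dot : forall c d, l2dot (Ol2_fun c) (Ol2_fun d) = l2dot c d }.

Section Ol2_group.
Variable R : realType.
Implicit Types g h k : Ol2 R.

Lemma Ol2_eq g h : g =1 h -> g = h.
Proof.
case: g h => [f ? ? ?] [f' ? ? ?] /= /funext ff'; subst f'.
by congr OrthogonalOperator; exact: Prop_irrelevance.
Qed.

Definition Ol2_one : Ol2 R.
Proof. by exists id => //; exists id. Defined.

Definition Ol2_mul g h : Ol2 R.
Proof.
exists (g \o h).
- by move=> a u v; rewrite /= !Ol2_linear.
- exact: bij_comp (Ol2_bij g) (Ol2_bij h).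
- by move=> c d; rewrite /= !Ol2_dot.
Defined.

Let inv_exists g : exists f, cancel g f /\ cancel f g.
Proof. by have [f] := Ol2_bij g; exists f. Qed.

Let inv_fun g := projT1 (cid (inv_exists g)).

Let inv_funK g : cancel g (inv_fun g).
Proof. exact: (projT2 (cid (inv_exists g))).1. Qed.

Let funK_inv g : cancel (inv_fun g) g.
Proof. exact: (projT2 (cid (inv_exists g))).2. Qed.

Definition Ol2_inv g : Ol2 R.
Proof.
exists (inv_fun g).
- by move=> a u v; apply: (can_inj (inv_funK g)); rewrite Ol2_linear !funK_inv.
- by exists g; [exact: funK_inv|exact: inv_funK].
- by move=> c d; rewrite -(Ol2_dot g) !funK_inv.
Defined.

Let mulA : associative Ol2_mul.
Proof. by move=> g h k; exact: Ol2_eq. Qed.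

Let mul1g' : left_id Ol2_one Ol2_mul.
Proof. by move=> g; exact: Ol2_eq. Qed.

Let mulg1' : right_id Ol2_one Ol2_mul.
Proof. by move=> g; exact: Ol2_eq. Qed.

Let mulV : left_inverse Ol2_one Ol2_inv Ol2_mul.
Proof. by move=> g; apply: Ol2_eq => c; exact: inv_funK. Qed.

Let mulgV' : right_inverse Ol2_one Ol2_inv Ol2_mul.
Proof. by move=> g; apply: Ol2_eq => c; exact: funK_inv. Qed.

HB.instance Definition _ := gen_eqMixin (Ol2 R).
HB.instance Definition _ := gen_choiceMixin (Ol2 R).
HB.instance Definition _ := isPointed.Build (Ol2 R) Ol2_one.
HB.instance Definition _ := isGroup.Build (Ol2 R) mulA mul1g' mulg1' mulV mulgV'.

(* The strong operator topology is the topology of pointwise convergence for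
   the norm of l2; see Ol2_cvgP. *)
HB.instance Definition _ := Topological.copy (Ol2 R)
  (initial_topology (fun g : Ol2 R => (g : {ptws l2 R -> l2 R}))).

Lemma Ol2_norm g c : `|g c| = `|c|.
Proof.
apply/eqP; rewrite -(@eqrXn2 _ 2)//; apply/eqP.
by rewrite -!l2dotxx Ol2_dot.
Qed.

Lemma Ol2B g c d : g (c - d) = g c - g d.
Proof. by rewrite addrC -scaleN1r Ol2_linear scaleN1r addrC. Qed.

Lemma Ol2_cvgP (F : set_system (Ol2 R)) g : Filter F ->
  F --> g <-> forall c, (fun h : Ol2 R => h c) @ F --> g c.
Proof.
move=> FF; pose emb h : {ptws l2 R -> l2 R} := h.
have -> : (forall c, (fun h : Ol2 R => h c) @ F --> g c) <->
    {ptws, emb @ F --> emb g} by rewrite pointwise_cvgP.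
split=> [Fg|Fg A].
  exact: cvg_comp Fg (@initial_continuous _ _ emb g).
rewrite nbhsE => -[_ [[B oB <-] Bg] BA].
by apply: (filterS BA); apply: Fg; exact: open_nbhs_nbhs.
Qed.

Let mul_continuous : continuous (fun p : Ol2 R * Ol2 R => (p.1 * p.2)%g).
Proof.
move=> [g h]; apply/Ol2_cvgP => c.
suff: (fun p : Ol2 R * Ol2 R => p.1 (p.2 c)) @ (g, h) --> g (h c) by [].
have /Ol2_cvgP g1 : (fun p : Ol2 R * Ol2 R => p.1) @ (g, h) --> g.
  exact: cvg_fst.
have /Ol2_cvgP h1 : (fun p : Ol2 R * Ol2 R => p.2) @ (g, h) --> h.
  exact: cvg_snd.
apply/cvgrPdist_lt => e e0; near=> p.
have -> : g (h c) - p.1 (p.2 c) = (g (h c) - p.1 (h c)) + p.1 (h c - p.2 c).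
  by rewrite Ol2B addrA subrK.
rewrite (le_lt_trans (ler_normD _ _))// Ol2_norm (splitr e) ltrD//; near: p.
- by move/cvgrPdist_lt: (g1 (h c)); apply; rewrite divr_gt0.
- by move/cvgrPdist_lt: (h1 c); apply; rewrite divr_gt0.
Unshelve. all: by end_near. Qed.

Let inv_continuous : continuous (fun g : Ol2 R => (g^-1)%g).
Proof.
move=> g; have gF : ProperFilter (nbhs g) by exact: nbhs_pfilter.
apply/Ol2_cvgP => c.
suff: (fun h : Ol2 R => (h^-1)%g c) @ g --> (g^-1)%g c by [].
have /Ol2_cvgP g1 : (fun h : Ol2 R => h) @ g --> g by exact: cvg_id.
apply/cvgrPdist_lt => e e0; near=> h.
have hK d : h ((h^-1)%g d) = d by rewrite -[LHS]/((h * h^-1)%g d) mulgV.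
have gK d : g ((g^-1)%g d) = d by rewrite -[LHS]/((g * g^-1)%g d) mulgV.
rewrite -(Ol2_norm h) Ol2B hK -[X in _ - X]gK distrC; near: h.
by move/cvgrPdist_lt: (g1 ((g^-1)%g c)); apply.
Unshelve. all: by end_near. Qed.

HB.instance Definition _ := PointedTopological_isTopologicalGroup.Build
  (Ol2 R) mul_continuous inv_continuous.

End Ol2_group.

(* The sigma-algebra of R^oo (coordinates numbered from 0) is the product
   sigma-algebra, which is also the Borel one. *)
Definition cylinders (R : realType) : set (set (nat -> R)) :=
  [set A | exists k (B : set R), measurable B /\ A = [set x | B (x k)]].

Definition Rinfty (R : realType) := g_sigma_algebraType (@cylinders R).

(* mu is the product of countably many copies of N(0,1). The cylinder sets
   below form a generating pi-system, so this determines mu. *)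
Definition is_gaussian_product (R : realType)
    (mu : probability (Rinfty R) R) : Prop :=
  forall n (A : nat -> set R), (forall k, measurable (A k)) ->
    mu [set x | forall k, (k < n)%N -> A k (x k)] =
    (\prod_(k < n) normal_prob 0 1 (A k))%E.

(* f represents the class zeta(c) = \sum_k c_k zeta_k, the sum converging in
   L^2(mu), where zeta_k x = x k. *)
Definition zeta_version (R : realType) (mu : probability (Rinfty R) R)
    (c : l2 R) (f : Rinfty R -> R) : Prop :=
  f \in Lfun mu 2%:E /\
  (fun n => 'N[mu]_2%:E[(fun x => (f x - (\sum_(k < n) c k * x k)%R)%:E)])%E
    @ \oo --> 0%E.

(* The identity zeta(g c) = zeta(c) \o g^-1 holds a.e. for any choice of
   representatives of zeta(c) and zeta(g c). *)
Definition gaussian_near_action (R : realType) (mu : probability (Rinfty R) R)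
    (a : Ol2 R -> Rinfty R -> Rinfty R) : Prop :=
  near_action mu a /\
  forall (g : Ol2 R) (c : l2 R) (f f' : Rinfty R -> R),
    zeta_version mu c f -> zeta_version mu (g c) f' ->
    {ae mu, forall x, f' x = f (a (g^-1)%g x)}.

(* Main.v *)
(** Consider a spatial action of a Polish group on (Y, nu) which is whirly: for
    all A, D of positive measure, nu (A `&` g^-1 D) > 0 for some g arbitrarily
    close to 1. For B Borel in Y, the set S_y = {g | g y \in B} has the Baire
    property. If S_y were comeager in V for a positive measure of y, and meager
    in W for a positive measure of y, with V and W nonempty and open, then some
    translates of V and W would overlap in a nonempty open set in which some S_y
    is both meager and comeager. Hence S_y is meager for almost every y or
    comeager for almost every y. Letting B range over a separating sequence, the
    orbit map of almost every y is constant off a meager set, so y is fixed; a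
    whirly action with almost all points fixed has a zero-one measure nu.

    The Gaussian near-action is whirly. Rotate e_i towards e_(n+i) by a small
    angle for i < m and by a right angle for m <= i < n. This is close to 1 and,
    up to the first n coordinates, it maps a Gaussian sequence x to the sequence
    C x_i + S z_i (i < m), z_i (i >= m), with z an independent copy of x. Given
    x, the law of this sequence is equivalent to that of z, because S > 0; so it
    falls into D with positive probability. *)

Require Import Defs.
From HB Require Import structures.
From mathcomp Require Import all_boot all_order all_algebra.
From mathcomp Require Import all_classical all_reals all_analysis.
From mathcomp Require Import measurable_realfun.
From mathcomp Require Import zify ring lra.

Set Implicit Arguments.
Unset Strict Implicit.
Unset Printing Implicit Defensive.

Import Order.TTheory GRing.Theory Num.Theory.
Import numFieldNormedType.Exports.

Local Open Scope classical_set_scope.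
Local Open Scope ring_scope.

(** * Meager sets and the Baire property *)

Section meager.
Context {T : topologicalType}.
Implicit Types A B V W : set T.

(** Stated through dense open sets rather than nowhere dense ones, to match the shape of
    [baire_space]. *)
Definition meager A := exists2 D : (set T)^nat,
  (forall n, open (D n) /\ dense (D n)) & A `<=` ~` \bigcap_n D n.

Lemma meagerS A B : A `<=` B -> meager B -> meager A.
Proof. by move=> AB [D oD BD]; exists D => //; exact: subset_trans BD. Qed.

Lemma open_dense_meager V : open V -> dense V -> meager (~` V).
Proof.
by move=> oO dO; exists (fun=> V) => // x /= nOx /(_ 0%N I).
Qed.

Lemma meager0 : meager set0.
Proof. by exists (fun=> setT) => // n; split; [exact: openT|move=> V; rewrite setIT]. Qed.

Lemma meager_bigcup (F : (set T)^nat) :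
  (forall n, meager (F n)) -> meager (\bigcup_n F n).
Proof.
move=> mF.
have /choice[D DP] : forall n, exists D : (set T)^nat,
    (forall m, open (D m) /\ dense (D m)) /\ F n `<=` ~` \bigcap_m D m.
  by move=> n; have [D] := mF n; exists D.
(* Indices that code no pair receive the whole space, which is open and dense. *)
exists (fun k => if @unpickle (nat * nat)%type k is Some (n, m) then D n m else setT).
  move=> k; case: unpickle => [[n m]|]; first exact: (DP n).1.
  by split; [exact: openT|move=> V; rewrite setIT].
move=> x [n _ Fx] Dx; apply: ((DP n).2 _ Fx) => m _.
by have := Dx (pickle (n, m)) I; rewrite pickleK.
Qed.

Lemma meagerU A B : meager A -> meager B -> meager (A `|` B).
Proof.
move=> mA mB; rewrite -bigcup2E; apply: meager_bigcup => -[|[|n]] //=.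
exact: meager0.
Qed.

Definition baire_property A :=
  exists2 V, open V & meager ((A `\` V) `|` (V `\` A)).

(** If [A] is [V] up to a meager set, its complement is the exterior of [V] up to a meager set,
    because the boundary of [V] is closed and nowhere dense. *)
Lemma baire_propertyC A : baire_property A -> baire_property (~` A).
Proof.
move=> [ V oO mO]; exists (interior (~` V)); first exact: open_interior.
have oV : open (V `|` interior (~` V)) by apply: openU => //; exact: open_interior.
have dV : dense (V `|` interior (~` V)).
  move=> W [w Ww] oW; apply: contrapT => nW.
  have WO : W `<=` ~` V by move=> x Wx Ox; apply: nW; exists x; split => //; left.
  apply: nW; exists w; split => //; right.
  by rewrite /interior /= nbhsE; exists W.
apply: meagerS (meagerU mO (open_dense_meager oV dV)) => x [[nAx nIx]|[Ix nnAx]].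
- have [Ox|nOx] := pselect (V x); first by left; right.
  by right => -[].
- left; left; split; first exact: contrapT.
  exact: interior_subset Ix.
Qed.

Lemma baire_property_bigcup (F : (set T)^nat) :
  (forall n, baire_property (F n)) -> baire_property (\bigcup_n F n).
Proof.
move=> BF.
have /choice[ V OP] : forall n, exists V, open V /\ meager ((F n `\` V) `|` (V `\` F n)).
  by move=> n; have [V] := BF n; exists V.
exists (\bigcup_n V n); first by apply: bigcup_open => n _; exact: (OP n).1.
apply: meagerS (meager_bigcup (fun n => (OP n).2)) => x.
move=> [[[n _ Fx] nO]|[[n _ Ox] nF]]; exists n => //.
- by left; split => // Ox; apply: nO; exists n.
- by right; split => // Fx; apply: nF; exists n.
Qed.

Lemma open_baire_property V : open V -> baire_property V.
Proof. by move=> oO; exists V => //; rewrite setDv setU0; exact: meager0. Qed.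

Lemma borel_baire_property A : <<s open >> A -> baire_property A.
Proof.
apply: smallest_sub; last exact: open_baire_property.
split; first exact/open_baire_property/open0.
- by move=> B; rewrite setTD; exact: baire_propertyC.
- exact: baire_property_bigcup.
Qed.

(** The open set that approximates [A] must meet [W], since otherwise [W] would meet [A] in a meager
    set; on the part inside [W], [A] is comeager. *)
Lemma nonmeager_open A W : baire_property A -> open W -> ~ meager (W `&` A) ->
  exists V, [/\ open V, V !=set0, V `<=` W & meager (V `\` A)].
Proof.
move=> [ V oO mO] oW nm; exists (W `&` V); split.
- exact: openI.
- apply: contrapT => /nonemptyPn WO0; apply: nm; apply: meagerS mO => x [Wx Ax].
  left; split => // Ox; have : (W `&` V) x by [].
  by rewrite WO0.
- exact: subIsetl.
- by apply: meagerS mO => x [[_ Ox] nAx]; right.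
Qed.

Definition baire_space := forall F : (set T)^nat,
  (forall n, open (F n) /\ dense (F n)) -> dense (\bigcap_n F n).

Lemma baire_space_open W : baire_space -> open W -> W !=set0 -> ~ meager W.
Proof.
move=> bT oW W0 [D oD WD]; have [x [Wx Dx]] := bT D oD W W0 oW.
exact: WD Dx.
Qed.

End meager.

Lemma meager_homeo (T : topologicalType) (f g : T -> T) (A : set T) :
  cancel f g -> cancel g f -> continuous f -> continuous g ->
  meager A -> meager (f @^-1` A).
Proof.
move=> fK gK cf cg [D oD AD]; exists (fun n => f @^-1` D n).
  move=> n; split; first by apply: open_comp => [x _|]; [exact: cf|exact: (oD n).1].
  move=> V [x Ox] oO.
  have [|y [Oy Dy]] := (oD n).2 (g @^-1` V) _ (open_comp (fun x _ => cg x) oO).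
    by exists (f x); rewrite /= fK.
  by exists (g y); split => //=; rewrite gK.
by move=> x /= Ax Dx; apply: (AD _ Ax) => n _; exact: Dx.
Qed.

Lemma basis_subopen (T : topologicalType) (U : (set T)^nat) (V : set T) x :
  basis (range U) -> open V -> V x -> exists n, U n x /\ U n `<=` V.
Proof.
move=> [_ bU] oO Ox; have [] := bU x V; first exact: open_nbhs_nbhs.
by move=> _ [[n _ <-] Ux] UO; exists n.
Qed.

(** * Whirly spatial actions of Baire groups *)

Section translation.
Variable G : topGroupType.

Lemma mulgr_continuous (k : G) : continuous (fun g : G => (g * k)%g).
Proof.
move=> g; apply: (@cvg_comp _ _ _ (fun g : G => (g, k)) (fun p : G * G => (p.1 * p.2)%g)
  _ _ _ _ (@mulg_continuous G (g, k))).
by apply: cvg_pair => //=; exact: cvg_cst.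
Qed.

Lemma mulgl_continuous (k : G) : continuous (fun g : G => (k * g)%g).
Proof.
move=> g; apply: (@cvg_comp _ _ _ (fun g : G => (k, g)) (fun p : G * G => (p.1 * p.2)%g)
  _ _ _ _ (@mulg_continuous G (k, g))).
by apply: cvg_pair => //=; exact: cvg_cst.
Qed.

Lemma meager_mulgr (k : G) (A : set G) :
  meager A -> meager [set g | A (g * k)%g].
Proof.
apply: (@meager_homeo _ (fun g => g * k)%g (fun g => g * k^-1)%g);
  [exact: mulgK|exact: mulgVK|exact: mulgr_continuous|exact: mulgr_continuous].
Qed.

Lemma meager_mulgl (k : G) (A : set G) :
  meager A -> meager [set g | A (k * g)%g].
Proof.
apply: (@meager_homeo _ (fun g => k * g)%g (fun g => k^-1 * g)%g);
  [exact: mulKg|exact: mulVKg|exact: mulgl_continuous|exact: mulgl_continuous].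
Qed.

Lemma open_mulgr (k : G) (V : set G) : open V -> open [set g | V (g * k)%g].
Proof. by apply: open_comp => g _; exact: mulgr_continuous. Qed.

End translation.

(** The sets are preimages of balls of radius 1/(k+1) centered in a countable dense set. Interiors
    are taken because balls need not be open. *)
Lemma standard_borel_separating (R : realType) d (Y : measurableType d) :
  standard_borel R Y -> exists E : (set Y)^nat,
    (forall n, measurable (E n)) /\
    forall y z, (forall n, E n y <-> E n z) -> y = z.
Proof.
move=> [P [f [hP [D cD dD] bf mY]]].
move: cD => /pcard_surjP[e eD].
pose B (p : nat * nat) := f @^-1` (interior (ball (e p.1) (p.2.+1%:R^-1 : R))).
exists (fun n => if unpickle n is Some p then B p else setT); split.
  move=> n; case: unpickle => // p; apply/mY.
  eexists; last by [].
  by apply: sub_sigma_algebra; exact: open_interior.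
move=> y z yz; apply: (bij_inj bf); apply: contrapT => fyz.
move: hP; rewrite ball_hausdorff => /(_ (f y) (f z)); case; first exact/eqP.
move=> [r s] /= /eqP/seteqP[rs _].
have [k kr] : exists k : nat, (k.+1%:R^-1 : R) < r%:num / 2.
  have [k] := ltr_add_invr (divr_gt0 (gt0 r) (ltr0n R 2)).
  by rewrite add0r => kr; exists k.
set q : R := k.+1%:R^-1 in kr *.
have q0 : 0 < q by rewrite invr_gt0.
(* The ball of radius [q] around such a center contains [f y]; if it also contained [f z], then
   [f z] would be within 3q/2 < r of [f y], contrary to the disjointness [rs]. *)
have [x [xy Dx]] : interior (ball (f y) (q / 2)) `&` D !=set0.
  apply: dD; last exact: open_interior.
  by exists (f y); apply: nbhsx_ballx; rewrite divr_gt0.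
have [n _ enx] := eD _ Dx.
have xy' : ball (f y) (q / 2) x by exact: interior_subset xy.
have [+ _] := yz (pickle (n, k)); rewrite pickleK /B /= enx -/q => yzn.
have /interior_subset xz : interior (ball x q) (f z).
  apply: yzn; apply: filterS (nbhsx_ballx (f y) (q / 2) _) => [w yw|].
    by rewrite [q]splitr; apply: ball_triangle yw; exact: ball_sym.
  by rewrite divr_gt0.
apply: (rs (f z)); split; last by exact: ballxx.
apply: le_ball (ball_triangle xy' xz); move: kr q0; clear; lra.
Qed.

Section spatial_action.
Context (R : realType) (G : topGroupType) d (Y : measurableType d)
  (nu : probability Y R) (b : G -> Y -> Y) (U : (set G)^nat).
Hypotheses (Us : basis (range U)) (bG : @baire_space G).
Hypotheses (mb : measurable_fun [set: borel G * Y] (fun p => b p.1 p.2))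
  (b1 : forall y, b 1%g y = y)
  (bM : forall g h y, b g (b h y) = b (g * h)%g y)
  (nub : forall g, preserves nu (b g)).

(** The Montgomery-Novikov theorem, by induction from the rectangles. All open [V] are treated at
    once, since complementation passes to smaller open sets: a section is comeager in [V] iff it is
    nonmeager in every nonempty [U n] inside [V]. *)
Lemma measurable_meager_section (C : set (borel G * Y)) : measurable C ->
  forall V : set G, open V ->
  measurable [set y | meager (V `&` [set g : G | C (g, y)])].
Proof.
rewrite measurable_prod_measurableType.
pose K := [set C : set (borel G * Y) | measurable C /\ forall V : set G, open V ->
  measurable [set y | meager (V `&` [set g : G | C (g, y)])]].
move=> mC; suff [] : K C by [].
have secB (D : set (borel G * Y)) (y : Y) : measurable D -> baire_property [set g : G | D (g, y)].
  move=> mD; apply: borel_baire_property.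
  have := measurable_ysection y mD; rewrite /ysection.
  by under eq_fun do rewrite in_setE.
move: C mC; apply: smallest_sub => [|_ [S mS [T mT] <-]].
  split.
  - split=> // V oV; rewrite (_ : [set _ | _] = setT)//.
    by apply/seteqP; split => // y _ /=; rewrite setI0; exact: meager0.
  - move=> C [mC KC]; rewrite setTD; split; first exact: measurableC.
    move=> V oV; rewrite (_ : [set _ | _] =
      \bigcap_(n in [set n | U n `<=` V /\ U n !=set0])
        ~` [set y | meager (U n `&` [set g : G | C (g, y)])]).
      apply: bigcap_measurableType => n [UV U0].
      by apply: measurableC; apply: KC; apply: Us.1; exists n.
    apply/seteqP; split => y /=.
      move=> mV n [UV U0] mU; apply: (baire_space_open bG (Us.1 _ _) U0); first by exists n.
      apply: meagerS (meagerU mV mU) => g Ug.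
      by have [Cg|nCg] := pselect (C (g, y)); [right|left; split => //; exact: UV].
    move=> mU; apply: contrapT => nm.
    have [W [oW [w Ww] WV mW]] := nonmeager_open (baire_propertyC (secB _ y mC)) oV nm.
    have [n [Unw UW]] := basis_subopen Us oW Ww.
    apply: (mU n); first by split; [exact: subset_trans UW WV|exists w].
    by apply: meagerS mW => g [Ug Cg]; split; [exact: UW|exact].
  - move=> F KF; split; first by apply: bigcupT_measurable => n; exact: (KF n).1.
    move=> V oV; rewrite (_ : [set _ | _] =
      \bigcap_n [set y | meager (V `&` [set g : G | F n (g, y)])]).
      by apply: bigcapT_measurable => n; exact: (KF n).2.
    apply/seteqP; split => y /=.
      move=> mV n _; apply: meagerS mV => g [Vg Fg]; split => //.
      by exists n.
    move=> mV; apply: meagerS (meager_bigcup (fun n => mV n I)) => g [Vg [n _ Fg]].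
    by exists n.
split; first by exact: measurableX.
move=> V oV; have [mVS|nVS] := pselect (meager (V `&` S)).
  rewrite (_ : [set _ | _] = setT)//; apply/seteqP; split => // y _ /=.
  by apply: meagerS mVS => g [Vg [Sg _]].
rewrite (_ : [set _ | _] = ~` T); first exact: measurableC.
apply/seteqP; split => y /=.
  by move=> mV Ty; apply: nVS; apply: meagerS mV => g [Vg Sg].
by move=> nTy; apply: meagerS meager0 => g [_ [_ /nTy]].
Qed.

(** The complement of this set is a Vaught transform of [B]: the points sent into [B] by nonmeagerly
    many elements of [V]. *)
Definition meager_on (V : set G) (B : set Y) :=
  [set y | meager (V `&` [set g | B (b g y)])].

Lemma measurable_meager_on V B : open V -> measurable B ->
  measurable (meager_on V B).
Proof.
move=> oV mB; apply: (@measurable_meager_section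
  ((fun p : borel G * Y => b p.1 p.2) @^-1` B)) => //.
by rewrite -[X in measurable X]setTI; exact: mb.
Qed.

(** Substitute [g * k] for [g]: right translation is a homeomorphism, so it preserves meager
    sets. *)
Lemma meager_on_mulgr V B k :
  meager_on [set g | V (g * k^-1)%g] B = b k @^-1` meager_on V B.
Proof.
apply/seteqP; split => y; rewrite /meager_on /= => my.
  have := meager_mulgr k my; apply: meagerS => g [Vg Bg]; split => /=.
    by rewrite mulgK.
  by rewrite -bM.
have := meager_mulgr k^-1%g my; apply: meagerS => g [Vg Bg]; split => //=.
by rewrite bM mulgVK.
Qed.

Lemma measure_meager_on_mulgr V B k : open V -> measurable B ->
  nu (meager_on [set g | V (g * k)%g] B) = nu (meager_on V B).
Proof.
move=> oV mB; rewrite -[k]invgK meager_on_mulgr.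
exact: nub (measurable_meager_on oV mB).
Qed.

Definition whirly := forall (V : set G) (A D : set Y), nbhs 1%g V ->
  measurable A -> measurable D -> nu A != 0%E -> nu D != 0%E ->
  exists2 g, V g & nu (A `&` b g @^-1` D) != 0%E.

Hypothesis wb : whirly.

(* Right translations change neither measure, so V and W may be assumed to
   contain 1. For y in the first set and g y in the second, with g in V, the
   trace of {h | h y \in B} on V `&` W g is then both meager and comeager. *)
Lemma whirly_meager_on V W B : measurable B -> open V -> V !=set0 ->
  open W -> W !=set0 ->
  nu (meager_on V (~` B)) = 0%E \/ nu (meager_on W B) = 0%E.
Proof.
move=> mB oV [v Vv] oW [w Ww]; have mBC := measurableC mB.
have [|nV] := eqVneq (nu (meager_on V (~` B))) 0%E; first by left.
have [|nW] := eqVneq (nu (meager_on W B)) 0%E; first by right.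
exfalso; rewrite -(measure_meager_on_mulgr v)// in nV.
rewrite -(measure_meager_on_mulgr w)// in nW.
pose V' := [set g | V (g * v)%g]; pose W' := [set g | W (g * w)%g].
rewrite -/V' -/W' in nV nW.
have oV' : open V' by exact: open_mulgr.
have oW' : open W' by exact: open_mulgr.
have V'1 : nbhs 1%g V'.
  by apply: open_nbhs_nbhs; split => //; rewrite /V' /= mul1g.
have [g V'g] := wb V'1 (measurable_meager_on oV' mBC) (measurable_meager_on oW' mB) nV nW.
set S := _ `&` _ => nS.
have [y [/= Vy Wy]] : S !=set0.
  by apply/set0P; apply: contra nS => /eqP ->; rewrite measure0.
have oO : open (V' `&` [set h | W' (h * g^-1)%g]).
  by apply: openI => //; exact: open_mulgr.
apply: (baire_space_open bG oO).
  by exists g; split => //=; rewrite mulgV /W' /= mul1g.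
move: Wy; rewrite -[b g y]/(b g y) => Wy.
have {}Wy : meager_on [set h | W' (h * g^-1)%g] B y by rewrite meager_on_mulgr.
apply: meagerS (meagerU Vy Wy) => h [Vh Wh].
by have [Bh|nBh] := pselect (B (b h y)); [right|left].
Qed.

(** By the Baire property, a nonmeager trace of [B] on an orbit is comeager in some nonempty [U n].
    The base is countable, so almost every [y] avoids this for all [n]. *)
Lemma ae_meager_on B : measurable B ->
  (forall n, U n !=set0 -> nu (meager_on (U n) (~` B)) = 0%E) ->
  {ae nu, forall y, meager_on setT B y}.
Proof.
move=> mB nuU.
have : {ae nu, forall y, forall n, U n !=set0 -> ~ meager_on (U n) (~` B) y}.
  apply: ae_foralln => n; have [U0|nU0] := pselect (U n !=set0).
    have mU : measurable (meager_on (U n) (~` B)).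
      by apply: measurable_meager_on (measurableC mB); apply: Us.1; exists n.
    exists (meager_on (U n) (~` B)); split => //; first exact: nuU.
    by move=> y /= ny; apply: contrapT => my; apply: ny.
  by apply: aeW.
apply: filterS => y yU; apply: contrapT => nm.
have Bb : baire_property [set g | B (b g y)].
  apply: borel_baire_property; rewrite -[X in <<s open >> X]setTI.
  have := measurable_ysection y (mb measurableT mB).
  rewrite setTI /ysection setTI; under eq_fun do rewrite in_setE; exact.
have [W [oW [w Ww] _ mW]] := nonmeager_open Bb openT nm.
have [n [Unw UW]] := basis_subopen Us oW Ww.
apply: (yU n); first by exists w.
by apply: meagerS mW => g [Ug Bg]; split => //; exact: UW.
Qed.

(** If the trace of [B] is comeager in some [U n] for a positive measure of points, then by
    [whirly_meager_on] it is meager in a given nonempty [U m] only for a null set of points, and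
    [ae_meager_on] applies to the complement. *)
Lemma whirly_meager_or B : measurable B ->
  {ae nu, forall y, meager_on setT B y} \/
  {ae nu, forall y, meager_on setT (~` B) y}.
Proof.
move=> mB.
have [nuU|/existsNP[n /not_implyP[U0 nuU]]] := pselect (forall n, U n !=set0 ->
    nu (meager_on (U n) (~` B)) = 0%E).
  by left; exact: ae_meager_on.
right; apply: ae_meager_on; first exact: measurableC.
move=> m Um0; rewrite setCK.
by have [] // := @whirly_meager_on (U n) (U m) B mB _ U0 _ Um0;
  apply: Us.1; [exists n|exists m].
Qed.

Lemma whirly_ae_fixed : standard_borel R Y ->
  {ae nu, forall y, forall g, b g y = y}.
Proof.
move=> /standard_borel_separating[E [mE sepE]].
have : {ae nu, forall y, forall n, meager_on setT (E n) y \/ meager_on setT (~` E n) y}.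
  apply: ae_foralln => n.
  by case: (whirly_meager_or (mE n)); apply: filterS => y; [left|right].
apply: filterS => y yE.
(* [Nn n] is a meager trace, either of [E n] or of its complement. For [g] outside all of them, the
   side of [E n] on which [b g y] lies does not depend on [g]. *)
pose Nn n := if pselect (meager_on setT (E n) y) then [set g | E n (b g y)]
  else [set g | ~ E n (b g y)].
have mN : meager (\bigcup_n Nn n).
  apply: meager_bigcup => n; rewrite /Nn; case: pselect => /= [|nE].
    by apply: meagerS => g Eg.
  by case: (yE n) => //; apply: meagerS => g Eg.
set N := \bigcup_n _ in mN.
have orb g h : ~ N g -> ~ N h -> b g y = b h y.
  move=> Ng Nh; apply: sepE => n.
  have {Ng} : ~ Nn n g by move=> ?; apply: Ng; exists n.
  have {Nh} : ~ Nn n h by move=> ?; apply: Nh; exists n.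
  by rewrite /Nn; case: pselect => /= _ ? ?; split => //; move=> _; exact: contrapT.
have exN (M : set G) : meager M -> exists g, ~ M g.
  move=> mM; apply: contrapT => /forallNP allM.
  apply: (@baire_space_open _ [set: G] bG openT); first by exists 1%g.
  by apply: meagerS mM => g _; exact: contrapT.
have [g0 Ng0] := exN _ mN.
(* Choose [g] with both [g] and [h * g] outside [N]: both send [y] to the common value [b g0 y]. *)
have fixp h : b h (b g0 y) = b g0 y.
  have [g /not_orP[Ng Nhg]] := exN _ (meagerU mN (meager_mulgl h mN)).
  by rewrite -[in LHS](orb g)// bM; exact: orb.
(* The fixed point [b g0 y] is sent back to [y] by the inverse of [g0], so it is [y] itself. *)
move=> g; have -> : y = b g0 y by rewrite -(fixp g0^-1%g) bM mulVg b1.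
exact: fixp.
Qed.

Lemma whirly_zero_one (A : set Y) : standard_borel R Y -> measurable A ->
  nu A = 0%E \/ nu (~` A) = 0%E.
Proof.
move=> sY mA.
have [|nA] := eqVneq (nu A) 0%E; first by left.
have [|nAC] := eqVneq (nu (~` A)) 0%E; first by right.
exfalso.
(* Some [g] would move a part of [A] of positive measure out of [A], although almost every point is
   fixed. *)
have [g _ /eqP] := wb filterT mA (measurableC mA) nA nAC; apply.
have mbg : measurable (b g @^-1` (~` A)).
  rewrite -[X in measurable X]setTI.
  have mg : measurable_fun setT (fun y => (g : borel G, y) : borel G * Y).
    exact: pair1_measurable.
  exact: (measurableT_comp mb mg) (measurableC mA).
apply/negligibleP; first exact: measurableI.
apply: negligibleS (whirly_ae_fixed sY) => y [Ay nAy] /= fy.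
by apply: nAy; rewrite fy.
Qed.

End spatial_action.

(** * The space l2 and its orthogonal group *)

Section l2.
Variable R : realType.
Implicit Types c d : l2 R.

(** Limits, basis vectors and images under rotations are obtained as elements of [l2] in this
    way. *)
Lemma l2_exists (f : nat -> R) M :
  (forall n, \sum_(0 <= k < n) f k * f k <= M) ->
  exists c : l2 R, (c : nat -> R) = f.
Proof.
move=> fM.
have mf : measurable_fun [set: nat] f by [].
have lf : f \in Lfun (@counting nat R) 2%:E.
  apply/andP; split; rewrite inE//=; rewrite /finite_norm.
  apply: (@lty_poweRy _ _ 2); first by [].
  rewrite poweR_Lnorm ?pnatr_eq0//.
  rewrite ge0_integral_count; last by move=> k; exact: poweR_ge0.
  apply: (@le_lt_trans _ _ M%:E); last exact: ltry.
  apply: lime_le.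
    by apply: is_cvg_nneseries => k _ _; exact: poweR_ge0.
  apply: nearW => n; rewrite (eq_bigr (fun k => (f k * f k)%:E)).
    by rewrite sumEFin lee_fin.
  move=> k _; rewrite abse_EFin poweR_EFin powR_mulrn//.
  by rewrite real_normK ?num_real// expr2.
by exists (Lfun_Sub (lee1n 2) lf).
Qed.

Lemma l2_sum_le c n : \sum_(0 <= k < n) c k * c k <= `|c| ^+ 2.
Proof.
have h := @cvg_l2norm_sqr R c; rewrite -(cvg_lim _ h)//.
apply: (@nondecreasing_cvgn_le R (series (fun k => c k * c k))); last exact: cvgP h.
by apply: nondecreasing_series => k _ _; rewrite -expr2 sqr_ge0.
Qed.

Lemma l2_norm_le c M : 0 <= M ->
  (forall n, \sum_(0 <= k < n) c k * c k <= M ^+ 2) -> `|c| <= M.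
Proof.
move=> M0 cM; rewrite -(@ler_pXn2r _ 2)// ?nnegrE//.
apply: (cvgr_to_le (@cvg_l2norm_sqr R c)).
by apply: nearW => n; exact: cM.
Qed.

Lemma l2_coord_le c k : `|c k| <= `|c|.
Proof.
rewrite -(@ler_pXn2r _ 2)// ?nnegrE// real_normK ?num_real//.
apply: le_trans (l2_sum_le c k.+1); rewrite big_nat_recr//= -expr2 lerDr.
by apply: sumr_ge0 => i _; rewrite -expr2 sqr_ge0.
Qed.

Lemma l2DE c d k : (c + d) k = c k + d k. Proof. by []. Qed.
Lemma l2BE c d k : (c - d) k = c k - d k. Proof. by []. Qed.
Lemma l2ZE a c k : (a *: c) k = a * c k. Proof. by []. Qed.

(** Polarization: a linear map that preserves the norm also preserves [l2dot]. *)
Lemma l2dotE c d : l2dot c d = (`|c + d| ^+ 2 - `|c| ^+ 2 - `|d| ^+ 2) / 2.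
Proof.
apply: cvg_lim => //.
apply: cvg_trans; last first.
  exact: (cvgMr_tmp (b := 2^-1 : R) (cvgB (cvgB (@cvg_l2norm_sqr R (c + d))
    (@cvg_l2norm_sqr R c)) (@cvg_l2norm_sqr R d))).
apply: near_eq_cvg; apply: nearW => n.
rewrite !fctE /series /= -!sumrB mulr_suml; apply: eq_bigr => k _.
by rewrite -[X in X * X - _ - _]/(c k + d k); field.
Qed.

(** Coordinates converge since the norm dominates them. The Cauchy bound passes to the limit in each
    finite sum of squares, hence in the norm. *)
Lemma l2_complete (u : (l2 R)^nat) :
  (forall e, 0 < e -> exists N, forall k l, (N <= k)%N -> (N <= l)%N ->
    `|u k - u l| <= e) ->
  exists c, u @ \oo --> c.
Proof.
move=> uC.
have uf j : cvgn (fun k => u k j).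
  apply/cauchy_cvgP/cauchyP => e e0.
  have [N uN] := uC (e / 2) (divr_gt0 e0 (ltr0n R 2)).
  exists (u N j); exists N => // k /= Nk; rewrite /ball /= -l2BE.
  apply: le_lt_trans (l2_coord_le _ _) _; apply: le_lt_trans (uN _ _ _ Nk) _ => //.
  by rewrite ltr_pdivrMr// ltr_pMr// ltr1n.
pose f j := limn (fun k => u k j).
have ufE e N : (forall k l, (N <= k)%N -> (N <= l)%N -> `|u k - u l| <= e) ->
    forall k, (N <= k)%N -> forall n,
    \sum_(0 <= j < n) (u k j - f j) * (u k j - f j) <= e ^+ 2.
  move=> uN k Nk n.
  have : (fun l => \sum_(0 <= j < n) (u k j - u l j) * (u k j - u l j)) @ \oo -->
      \sum_(0 <= j < n) (u k j - f j) * (u k j - f j).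
    apply: cvg_big => [|j _]; first exact: add_continuous.
    apply: cvgM; apply: cvgB; try exact: cvg_cst; exact: uf.
  move/cvgr_to_le; apply; near=> l.
  apply: le_trans (l2_sum_le (u k - u l) n) _.
  rewrite lerXn2r ?nnegrE//; first by apply: le_trans (uN k k Nk Nk); exact: normr_ge0.
  by apply: uN => //; near: l; exact: nbhs_infty_ge.
have [N1 uN1] := uC 1 ltr01.
(* The coordinatewise limit [f] is in [l2] because [u N1] and the difference of [u N1] and [f]
   are. *)
have [c' c'E] := l2_exists (ufE _ _ uN1 N1 (leqnn N1)).
have uc' j : (u N1 - c') j = f j by rewrite l2BE c'E opprB addrCA subrr addr0.
exists (u N1 - c'); apply/cvgrPdist_le => e e0.
have [N uN] := uC e e0; exists N => // k /= Nk.
rewrite distrC; apply: l2_norm_le; first exact: ltW.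
move=> n; under eq_bigr do rewrite l2BE uc'.
exact: (ufE e N uN k Nk n).
Unshelve. all: by end_near. Qed.
End l2.

Section delta.
Variable R : realType.
Implicit Types c d : l2 R.

Let delta_bounded (i n : nat) :
  \sum_(0 <= k < n) ((k == i)%:R : R) * (k == i)%:R <= 1.
Proof.
rewrite big_mkord (eq_bigr (fun k : 'I_n => if nat_of_ord k == i then 1 else 0 : R)); last first.
  by move=> k _; case: eqP; rewrite ?mulr1 ?mul0r.
rewrite -big_mkcond /=; case: (ltnP i n) => [ni|ni].
  by rewrite (big_pred1 (Ordinal ni)).
rewrite big_pred0//= => k; apply/negbTE; apply: contraTN ni => /eqP <-.
by rewrite -ltnNge.
Qed.

Definition l2_delta (i : nat) : l2 R := projT1 (cid (l2_exists (@delta_bounded i))).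

Lemma l2_deltaE i k : l2_delta i k = (k == i)%:R.
Proof. by rewrite /l2_delta; case: cid => c /= ->. Qed.

Lemma l2_norm_delta i : `|l2_delta i| <= 1.
Proof.
apply: l2_norm_le => // n; rewrite expr1n.
by under eq_bigr do rewrite l2_deltaE; exact: delta_bounded.
Qed.

Lemma l2_eq c d : (forall k, c k = d k) -> c = d.
Proof. by move=> cd; apply/LfuneqP. Qed.

Lemma l2_sumE (I : Type) (r : seq I) (F : I -> l2 R) k :
  (\sum_(i <- r) F i) k = \sum_(i <- r) F i k.
Proof.
elim: r => [|i r ih]; first by rewrite !big_nil.
by rewrite !big_cons -ih.
Qed.

Definition l2_trunc n c : l2 R := \sum_(0 <= i < n) c i *: l2_delta i.

Lemma l2_truncE n c k : l2_trunc n c k = if (k < n)%N then c k else 0.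
Proof.
rewrite /l2_trunc l2_sumE big_mkord.
rewrite (eq_bigr (fun i : 'I_n => if nat_of_ord i == k then c i else 0)); last first.
  by move=> i _; rewrite l2ZE l2_deltaE eq_sym; case: eqP; rewrite ?mulr1 ?mulr0.
rewrite -big_mkcond /=; case: ltnP => [kn|nk]; first by rewrite (big_pred1 (Ordinal kn)).
rewrite big_pred0//= => i; apply/negbTE; apply: contraTN nk => /eqP <-.
by rewrite -ltnNge.
Qed.

Lemma l2_trunc_close c e : 0 < e -> exists n, `|c - l2_trunc n c| <= e.
Proof.
move=> e0; have := @cvg_l2norm_sqr R c.
move/cvgrPdist_le => /(_ (e ^+ 2)); rewrite exprn_gt0// => /(_ isT)[n _ /(_ n (leqnn n))] /= cn.
exists n; apply: l2_norm_le; first exact: ltW.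
move=> N; move: (c - l2_trunc n c) (fun k => l2BE c (l2_trunc n c) k) => d dE0.
have dE k : d k = if (k < n)%N then 0 else c k.
  by rewrite dE0 l2_truncE; case: ifP; rewrite ?subrr ?subr0.
apply: (@le_trans _ _ (\sum_(0 <= k < n + N) d k * d k)).
  rewrite addnC [leRHS](@big_cat_nat _ _ _ N)//= ?leq_addr// lerDl.
  by apply: sumr_ge0 => k _; rewrite -expr2 sqr_ge0.
rewrite (@big_cat_nat _ _ _ n)//= ?leq_addr// big_nat big1 ?add0r; last first.
  by move=> k /andP[_ kn]; rewrite dE kn mul0r.
rewrite big_nat (eq_bigr (fun k => c k * c k)); last first.
  by move=> k /andP[nk _]; rewrite dE ltnNge nk.
rewrite -big_nat; apply: le_trans cn.
rewrite ler_normr; apply/orP; left; rewrite lerBrDl.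
apply: le_trans (l2_sum_le c (n + N)).
by rewrite [leRHS](@big_cat_nat _ _ _ n)//= leq_addr.
Qed.

End delta.

(** * The strong operator topology: countable base and Baire category *)

Section Ol2_topology.
Variable R : realType.
Implicit Types (c d : l2 R) (g h : Ol2 R).

Lemma Ol2_0 g : g 0 = 0.
Proof. by have := Ol2B g 0 0; rewrite !subrr. Qed.

Lemma Ol2_sum g (I : Type) (r : seq I) (a : I -> R) (F : I -> l2 R) :
  g (\sum_(i <- r) a i *: F i) = \sum_(i <- r) a i *: g (F i).
Proof.
elim: r => [|i r ih]; first by rewrite !big_nil Ol2_0.
by rewrite !big_cons Ol2_linear ih.
Qed.

(** One index sets both the number of basis vectors and the accuracy, so that these neighborhoods
    decrease with [m]. *)
Definition Ol2_near m g : set (Ol2 R) :=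
  [set h | forall i, (i < m)%N -> `|h (l2_delta R i) - g (l2_delta R i)| < m.+1%:R^-1].

Lemma invS_le (m n : nat) : (m <= n)%N -> (n.+1%:R^-1 : R) <= m.+1%:R^-1.
Proof. by move=> mn; rewrite lef_pV2 ?posrE// ler_nat. Qed.

Lemma invS_lt_exists (e : R) k : 0 < e -> exists m, (k <= m)%N /\ m.+1%:R^-1 < e.
Proof.
move=> /ltr_add_invr[m]; rewrite add0r => me; exists (maxn k m).
by rewrite leq_maxl; split => //; apply: le_lt_trans me; apply/invS_le/leq_maxr.
Qed.

Lemma Ol2_near_anti m n g : (m <= n)%N -> Ol2_near n g `<=` Ol2_near m g.
Proof.
move=> mn h hn i im; apply: lt_le_trans (hn _ (leq_trans im mn)) _.
exact: invS_le.
Qed.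

(** Approximate [c] by a finite combination of basis vectors. Orthogonal operators are isometries,
    so the error is uniform in [g] and [h], and [m] depends on [c] and [e] only. *)
Lemma Ol2_near_close c e : 0 < e ->
  exists m, forall g h, Ol2_near m g h -> `|h c - g c| < e.
Proof.
move=> e0; have e40 : 0 < e / 4 by rewrite divr_gt0.
have [n cn] := l2_trunc_close c e40.
pose K := \sum_(0 <= i < n) `|c i|.
have K0 : 0 <= K by apply: sumr_ge0.
have K10 : 0 < K + 1 by rewrite ltr_wpDl.
(* [m] covers all basis vectors of the truncation and makes K/(m+1) at most e/4; [K + 1] guards
   against division by zero. *)
have [m [nm me]] := invS_lt_exists n (divr_gt0 e40 K10).
exists m => g h gh; set t := l2_trunc n c in cn.
have -> : h c - g c = h (c - t) + (h t - g t) - g (c - t).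
  by rewrite !Ol2B addrA subrK opprB addrA subrK.
have ht : `|h t - g t| <= e / 4.
  rewrite /t /l2_trunc !Ol2_sum -sumrB.
  apply: le_trans (ler_norm_sum _ _ _) _.
  apply: (@le_trans _ _ (K * m.+1%:R^-1)).
    rewrite mulr_suml big_nat [leRHS]big_nat; apply: ler_sum => i /andP[_ ni].
    rewrite -scalerBr normrZ ler_wpM2l//; apply: ltW; apply: gh.
    exact: leq_trans ni nm.
  have K1 : K <= K + 1 by rewrite lerDl.
  apply: (@le_trans _ _ ((K + 1) * m.+1%:R^-1)); first by rewrite ler_wpM2r.
  by rewrite mulrC -ler_pdivlMr// ltW.
apply: le_lt_trans (ler_normB _ _) _.
apply: (@le_lt_trans _ _ (e / 4 + e / 4 + e / 4)); last by lra.
apply: lerD; last by rewrite Ol2_norm.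
by apply: le_trans (ler_normD _ _) _; rewrite lerD// Ol2_norm.
Qed.

Lemma nbhs_Ol2_near m g : nbhs g (Ol2_near m g).
Proof.
(* The radius is separated from the number of vectors, so that it stays fixed during the
   induction. *)
suff H r j : 0 < r -> nbhs g [set h : Ol2 R | forall i, (i < j)%N ->
    `|h (l2_delta R i) - g (l2_delta R i)| < r].
  by apply: H; rewrite invr_gt0.
move=> r0; elim: j => [|j ih]; first by apply: filterS filterT => h _ i.
have gF : ProperFilter (nbhs g) by exact: nbhs_pfilter.
have /Ol2_cvgP g1 : (fun h : Ol2 R => h) @ g --> g by exact: cvg_id.
have : nbhs g [set h : Ol2 R | `|g (l2_delta R j) - h (l2_delta R j)| < r].
  by move/cvgrPdist_lt: (g1 (l2_delta R j)); apply.
apply: filterS2 ih => h hi hj i.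
by rewrite ltnS leq_eqVlt => /orP[/eqP ->|/hi//]; rewrite distrC.
Qed.

(** By [Ol2_near_close], the filter generated by the sets [Ol2_near m g] converges to [g] pointwise,
    so it contains every neighborhood of [g]. *)
Lemma nbhs_Ol2P g (A : set (Ol2 R)) :
  nbhs g A <-> exists m, Ol2_near m g `<=` A.
Proof.
split=> [|[m mA]]; last exact: filterS mA (nbhs_Ol2_near m g).
pose F : set_system (Ol2 R) := filter_from setT (fun m => Ol2_near m g).
have FF : Filter F.
  apply: filter_from_filter; first by exists 0%N.
  move=> m n _ _; exists (maxn m n) => // h hmn.
  by split; apply: Ol2_near_anti hmn; [exact: leq_maxl|exact: leq_maxr].
have : F --> g.
  apply/Ol2_cvgP => c; apply/cvgrPdist_lt => e e0.
  have [m me] := Ol2_near_close c e0; exists m => // h gh.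
  by rewrite distrC; exact: me.
by move=> /[apply] -[m _ mA]; exists m.
Qed.

Lemma open_Ol2_dist c d r : open [set h : Ol2 R | `|h c - d| < r].
Proof.
rewrite openE => g /= gd; rewrite /interior /=.
have gr : 0 < r - `|g c - d| by rewrite subr_gt0.
have [m me] := Ol2_near_close c gr; apply/nbhs_Ol2P; exists m => h /me hg /=.
have -> : h c - d = (h c - g c) + (g c - d) by rewrite addrA subrK.
by apply: le_lt_trans (ler_normD _ _) _; rewrite -ltrBrDr.
Qed.

Definition l2_rat (s : seq rat) : l2 R :=
  \sum_(0 <= i < size s) ratr s`_i *: l2_delta R i.

Lemma l2_rat_dense c e : 0 < e -> exists s, `|c - l2_rat s| < e.
Proof.
move=> e0; have e20 : 0 < e / 2 by rewrite divr_gt0.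
have [n cn] := l2_trunc_close c e20.
have n0 : 0 < n.+1%:R :> R by [].
have /choice[q qc] : forall i, exists q : rat, `|c i - ratr q| < e / 2 / n.+1%:R.
  move=> i; have d0 := divr_gt0 e20 n0.
  have /rat_in_itvoo[q] : c i < c i + e / 2 / n.+1%:R by rewrite ltrDl.
  rewrite in_itv /= => /andP[cq qc]; exists q.
  by rewrite distrC gtr0_norm ?subr_gt0// ltrBlDl.
exists (mkseq q n); rewrite /l2_rat size_mkseq.
have -> : c - \sum_(0 <= i < n) ratr (mkseq q n)`_i *: l2_delta R i =
    (c - l2_trunc n c) + \sum_(0 <= i < n) (c i - ratr (q i)) *: l2_delta R i.
  rewrite /l2_trunc; under [X in _ = _ + X]eq_bigr do rewrite scalerBl.
  rewrite sumrB addrA subrK; congr (_ - _); apply: eq_big_nat => i /andP[_ ni].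
  by rewrite nth_mkseq.
apply: le_lt_trans (ler_normD _ _) _; rewrite [e]splitr ler_ltD//.
apply: le_lt_trans (ler_norm_sum _ _ _) _.
apply: (@le_lt_trans _ _ (\sum_(0 <= i < n) (e / 2 / n.+1%:R))).
  apply: ler_sum => i _; rewrite normrZ -[leRHS]mulr1 ler_pM//; first exact/ltW.
  exact: l2_norm_delta.
rewrite big_const_nat subn0 iter_addr_0 -[X in X < _]mulr_natr [X in X < _]mulrAC.
by rewrite ltr_pdivrMr// ltr_pM2l// ltr_nat.
Qed.


(** The centers are lists of rational vectors, not operators, which makes the family countable; some
    members may be empty. *)
Definition Ol2_base (p : seq (seq rat) * nat) : set (Ol2 R) :=
  [set h | forall i, (i < size p.1)%N ->
    `|h (l2_delta R i) - l2_rat (nth [::] p.1 i)| < p.2.+1%:R^-1].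

Lemma open_Ol2_base p : open (Ol2_base p).
Proof.
case: p => s k; rewrite openE => g gs.
suff H j : (j <= size s)%N -> nbhs g [set h : Ol2 R | forall i, (i < j)%N ->
    `|h (l2_delta R i) - l2_rat (nth [::] s i)| < k.+1%:R^-1] by exact: H.
elim: j => [_|j ih js]; first by apply: filterS filterT => h _ i.
have : nbhs g [set h : Ol2 R | `|h (l2_delta R j) - l2_rat (nth [::] s j)| < k.+1%:R^-1].
  by apply: open_nbhs_nbhs; split; [exact: open_Ol2_dist|exact: gs].
apply: filterS2 (ih (ltnW js)) => h hi hj i.
by rewrite ltnS leq_eqVlt => /orP[/eqP ->|/hi//].
Qed.

Definition Ol2_basis (n : nat) : set (Ol2 R) :=
  if @unpickle (seq (seq rat) * nat)%type n is Some p then Ol2_base p else set0.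

Lemma basis_Ol2_basis : basis (range Ol2_basis).
Proof.
split.
  move=> _ [n _ <-]; rewrite /Ol2_basis; case: unpickle => [p|]; last exact: open0.
  exact: open_Ol2_base.
move=> g A /nbhs_Ol2P[m mA].
(* Half the radius: both [g] and [h] are compared with the rational vector. *)
have e0 : 0 < (m.+1%:R^-1 : R) / 2 by rewrite divr_gt0.
have [k [_ ke]] := invS_lt_exists 0 e0.
have /choice[s sg] : forall i, exists s, `|g (l2_delta R i) - l2_rat s| < k.+1%:R^-1.
  by move=> i; apply: l2_rat_dense; rewrite invr_gt0.
pose p := (mkseq s m, k).
exists (Ol2_base p).
  split; first by exists (pickle p) => //; rewrite /Ol2_basis pickleK.
  by move=> i /=; rewrite size_mkseq => im; rewrite nth_mkseq.
move=> h hp; apply: mA => i im.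
have := hp i; rewrite /= size_mkseq nth_mkseq// => /(_ im) his.
have -> : h (l2_delta R i) - g (l2_delta R i) =
    (h (l2_delta R i) - l2_rat (s i)) - (g (l2_delta R i) - l2_rat (s i)).
  by rewrite opprB addrA subrK.
apply: le_lt_trans (ler_normB _ _) _; rewrite [ltRHS]splitr.
by apply: ltrD; [exact: lt_trans his ke|exact: lt_trans (sg i) ke].
Qed.

(** Two distances 1/(n+1) add up to at most 1/(m+1), because 2m < n. *)
Lemma Ol2_near_trans m n g h k : (m.*2 < n)%N ->
  Ol2_near n g h -> Ol2_near n g k -> Ol2_near m h k.
Proof.
move=> mn gh gk i im; have iN : (i < n)%N by lia.
have -> : k (l2_delta R i) - h (l2_delta R i) =
    (k (l2_delta R i) - g (l2_delta R i)) - (h (l2_delta R i) - g (l2_delta R i)).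
  by rewrite opprB addrA subrK.
apply: le_lt_trans (ler_normB _ _) _.
apply: (@lt_le_trans _ _ (n.+1%:R^-1 + n.+1%:R^-1)).
  by apply: ltrD; [exact: gk|exact: gh].
have -> : n.+1%:R^-1 + n.+1%:R^-1 = 2 / n.+1%:R :> R by rewrite mulrDl mul1r.
rewrite ler_pdivrMr// mulrC ler_pdivlMr// -natrM ler_nat; lia.
Qed.

(** Completeness for the two-sided uniformity: the operators and their inverses converge pointwise,
    and the two limits are inverse to each other. *)
Lemma Ol2_limit (u : (Ol2 R)^nat) :
  (forall m, exists N, forall k l, (N <= k)%N -> (N <= l)%N ->
     Ol2_near m (u k) (u l) /\ Ol2_near m (u k)^-1%g (u l)^-1%g) ->
  exists g, (forall c, (fun k => u k c) @ \oo --> g c) /\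
    (forall c, (fun k => (u k)^-1%g c) @ \oo --> g^-1%g c).
Proof.
move=> uC.
have lim_exists (v : (Ol2 R)^nat) : (forall m, exists N, forall k l,
      (N <= k)%N -> (N <= l)%N -> Ol2_near m (v k) (v l)) ->
    exists f : l2 R -> l2 R, forall c, (fun k => v k c) @ \oo --> f c.
  move=> vC; suff /choice[f fP] : forall c, exists d, (fun k => v k c) @ \oo --> d by exists f.
  move=> c; apply: l2_complete => e e0.
  have [m me] := Ol2_near_close c e0; have [N vN] := vC m.
  by exists N => k l Nk Nl; apply/ltW/me/vN.
have [f fP] : exists f : l2 R -> l2 R, forall c, (fun k => u k c) @ \oo --> f c.
  by apply: lim_exists => m; have [N uN] := uC m; exists N => k l Nk Nl; apply: (uN k l _ _).1.
have [f' f'P] : exists f : l2 R -> l2 R, forall c, (fun k => (u k)^-1%g c) @ \oo --> f c.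
  apply: (lim_exists (fun k => (u k)^-1%g)) => m; have [N uN] := uC m.
  by exists N => k l Nk Nl; apply: (uN k l _ _).2.
(* Composition passes to pointwise limits because every [v k] is an isometry. *)
have comp_lim (v w : (Ol2 R)^nat) a b : (forall c, (fun k => v k c) @ \oo --> a c) ->
    (forall c, (fun k => w k c) @ \oo --> b c) -> (forall k c, v k (w k c) = c) ->
    cancel b a.
  move=> va wb vw c; suff : (fun k => v k (w k c)) @ \oo --> a (b c).
    under eq_fun do rewrite vw; move=> /(cvg_lim (@norm_hausdorff _ _)) <-.
    by rewrite lim_cst//; exact: norm_hausdorff.
  apply/cvgrPdist_le => e e0; near=> k.
  have -> : a (b c) - v k (w k c) = (a (b c) - v k (b c)) + v k (b c - w k c).
    by rewrite Ol2B addrA subrK.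
  apply: le_trans (ler_normD _ _) _; rewrite Ol2_norm [e]splitr lerD//; near: k.
    by move/cvgrPdist_le : (va (b c)); apply; rewrite divr_gt0.
  by move/cvgrPdist_le : (wb c); apply; rewrite divr_gt0.
have flin : linear f.
  move=> a c d; apply: (cvg_unique (@norm_hausdorff _ _) (fP (a *: c + d))).
  have -> : (fun k => u k (a *: c + d)) = (fun k => a *: u k c + u k d).
    by apply/funext => k; rewrite Ol2_linear.
  by apply: cvgD; [apply: cvgZl_tmp; exact: fP|exact: fP].
have fnorm c : `|f c| = `|c|.
  apply: (cvg_unique (@norm_hausdorff _ _) (cvg_norm (fP c))).
  have -> : (fun k => `|u k c|) = cst `|c| by apply/funext => k; rewrite Ol2_norm.
  exact: cvg_cst.
have fK : cancel f f'.
  apply: (comp_lim _ _ _ _ f'P fP) => k c.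
  by rewrite -[LHS]/(((u k)^-1 * u k)%g c) mulVg.
have f'K : cancel f' f.
  apply: (comp_lim _ _ _ _ fP f'P) => k c.
  by rewrite -[LHS]/((u k * (u k)^-1)%g c) mulgV.
have fbij : bijective f by exists f'.
have fdot c d : l2dot (f c) (f d) = l2dot c d.
  by rewrite !l2dotE !fnorm -[f c]scale1r -flin fnorm scale1r.
pose g := OrthogonalOperator flin fbij fdot.
exists g; split => // c.
suff -> : (g^-1)%g c = f' c by [].
apply: (bij_inj fbij); rewrite -[LHS]/((g * g^-1)%g c) mulgV /=.
by rewrite f'K.
Unshelve. all: by end_near. Qed.

(* The neighborhoods control the inverses as well, since otherwise the limit of
   a Cauchy sequence of orthogonal operators might not be surjective. *)
Lemma Ol2_baire : @baire_space (Ol2 R).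
Proof.
move=> D oD W [w Ww] oW.
pose N m g := [set h | Ol2_near m g h /\ Ol2_near m g^-1%g h^-1%g].
(* [C] has weak inequalities where [N] has strict ones, so it retains the limits of sequences in
   it. *)
pose C m (g : Ol2 R) := [set h : Ol2 R | forall i, (i < m)%N ->
  `|h (l2_delta R i) - g (l2_delta R i)| <= m.+1%:R^-1 /\
  `|h^-1%g (l2_delta R i) - g^-1%g (l2_delta R i)| <= m.+1%:R^-1].
have nbhsN m g : nbhs g (N m g).
  apply: filterI; first exact: nbhs_Ol2_near.
  exact: (@invg_continuous (Ol2 R) g) (nbhs_Ol2_near m g^-1%g).
have step (A : set (Ol2 R)) k : open A -> A !=set0 ->
    exists m g, [/\ (k <= m)%N, C m g `<=` A & A g].
  move=> oA [g Ag]; have /nbhs_Ol2P[m mA] := open_nbhs_nbhs (conj oA Ag).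
  (* One level beyond [m], so that the weak bound is strictly below 1/(m+1). *)
  exists (maxn m.+1 k), g; split => //; first exact: leq_maxr.
  move=> h hC; apply: mA => i im.
  have mm : (m < maxn m.+1 k)%N by exact: leq_maxl.
  apply: le_lt_trans (hC i (ltn_trans im mm)).1 _.
  by rewrite ltf_pV2 ?posrE// ltr_nat ltnS.
have next (s : nat * Ol2 R) k : exists t : nat * Ol2 R,
    [/\ (k <= t.1)%N, C t.1 t.2 `<=` N s.1 s.2 & C t.1 t.2 `<=` D k].
  have [oI I0] : open (interior (N s.1 s.2) `&` D k) /\ interior (N s.1 s.2) `&` D k !=set0.
    split; first by apply: openI; [exact: open_interior|exact: (oD k).1].
    by apply: (oD k).2; [exists s.2; exact: nbhsN|exact: open_interior].
  have [m [g [km CA _]]] := step _ k oI I0.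
  exists (m, g); split => //= h /CA [] //.
  by move=> /interior_subset.
have [m0 [g0 [_ C0 _]]] := step W 0%N oW (ex_intro _ w Ww).
have /choice[nx nxP] : forall p : (nat * Ol2 R) * nat, exists t : nat * Ol2 R,
    [/\ (p.2 <= t.1)%N, C t.1 t.2 `<=` N p.1.1 p.1.2 & C t.1 t.2 `<=` D p.2].
  by move=> [s k]; exact: next.
pose s := fix s k := if k is k'.+1 then nx (s k', k') else (m0, g0).
have NC m g : N m g `<=` C m g.
  by move=> h [hg hg'] i im; split; apply: ltW; [exact: hg|exact: hg'].
have Cself m g : C m g g by move=> i im; rewrite !subrr normr0.
have Csub k l : (k < l)%N -> C (s l).1 (s l).2 `<=` N (s k).1 (s k).2.
  elim: l => // l ih; rewrite ltnS leq_eqVlt => /orP[/eqP ->|kl].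
    by have [] := nxP (s l, l).
  apply: subset_trans (ih kl); apply: subset_trans (@NC _ _).
  by have [] := nxP (s l, l).
have sk k : (k <= (s k.+1).1)%N by have [] := nxP (s k, k).
pose u k := (s k).2.
have [|g [gP g'P]] := @Ol2_limit u.
  (* Term number 2m+2 has level above 2m, as [Ol2_near_trans] requires, and all later terms lie in
     its neighborhood. *)
  move=> m; exists m.*2.+3 => k l mk ml.
  have mM : (m.*2 < (s m.*2.+2).1)%N by apply: leq_trans (sk _).
  have [uk uk'] := Csub _ _ mk _ (Cself (s k).1 (s k).2).
  have [ul ul'] := Csub _ _ ml _ (Cself (s l).1 (s l).2).
  by split; [exact: Ol2_near_trans mM uk ul|exact: Ol2_near_trans mM uk' ul'].
have gC k : C (s k).1 (s k).2 g.
  move=> i ik; split.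
    apply: (cvgr_to_le (cvg_norm (cvgB (gP (l2_delta R i)) (cvg_cst _)))).
    exists k.+1 => // l kl /=; have := Csub _ _ kl _ (Cself (s l).1 (s l).2).
    by move=> /NC /(_ i ik)[].
  apply: (cvgr_to_le (cvg_norm (cvgB (g'P (l2_delta R i)) (cvg_cst _)))).
  exists k.+1 => // l kl /=; have := Csub _ _ kl _ (Cself (s l).1 (s l).2).
  by move=> /NC /(_ i ik)[].
exists g; split; first exact: C0 (gC 0%N).
move=> k _; have [_ _] := nxP (s k, k); apply; exact: (gC k.+1).
Qed.

End Ol2_topology.

(** * The Gaussian measure on R^oo *)

Lemma pushforward_measure d1 d2 (T1 : measurableType d1) (T2 : measurableType d2)
    (R : realType) (m : {measure set T1 -> \bar R}) (f : T1 -> T2) :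
  measurable_fun [set: T1] f ->
  exists nu : {measure set T2 -> \bar R}, forall B, nu B = m (f @^-1` B).
Proof.
move=> mf; pose nu : {measure set T2 -> \bar R} := pushforward m f.
by exists (nu mf).
Qed.

(** * Null sets of the normal law and of product measures *)

Section null_sets.
Variable R : realType.
Local Notation leb := (@lebesgue_measure R).
Local Notation N01 := (@normal_prob R 0 1).
Implicit Types A : set R.

(** The normal density is positive everywhere, so its integral vanishes only over Lebesgue-null
    sets. *)
Lemma normal_prob_null A : measurable A -> N01 A = 0%E -> leb A = 0%E.
Proof.
move=> mA; rewrite /normal_prob => A0.
have pdf0 x : 0 < normal_pdf 0 1 x :> R.
  by rewrite /normal_pdf (negbTE (oner_neq0 R)) mulr_gt0 ?normal_peak_gt0 ?oner_neq0// expR_gt0.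
have mf : measurable_fun A (EFin \o normal_pdf (0 : R) 1).
  by apply/measurable_EFinP/measurable_funTS; exact: measurable_normal_pdf.
have : ae_eq leb A (EFin \o normal_pdf (0 : R) 1) (cst 0%E).
  apply/ae_eq_integral_abs => //; rewrite -[RHS]A0; apply: eq_integral => x _.
  by rewrite gee0_abs// lee_fin ltW.
move=> h; apply/negligibleP => //; apply: negligibleS h => x Ax /= /(_ Ax) [].
by apply/eqP; rewrite gt_eqF.
Qed.

(** The right-hand side is a measure in [A] that gives half-open intervals their length, so
    uniqueness of Lebesgue measure applies. *)
Lemma lebesgue_measure_affine (a b : R) A : 0 < a -> measurable A ->
  leb A = (a%:E * leb ((fun t => a * t + b)%R @^-1` A))%E.
Proof.
move=> a0 mA; pose F (t : R) : R := a * t + b.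
have mF : measurable_fun [set: R] F.
  by apply: measurable_funD => //; apply: measurable_funM.
have [nu nuE] : exists nu : {measure set (measurableTypeR R) -> \bar R},
    forall B, nu B = (a%:E * leb (F @^-1` B))%E.
  have [m mE] := @pushforward_measure _ _ (measurableTypeR R) (measurableTypeR R) R leb F mF.
  by exists (mscale (NngNum (ltW a0)) m) => B; rewrite -mE.
rewrite -nuE; apply: lebesgue_measure_unique => // X [[p q] _ <-] /=; rewrite nuE.
have -> : F @^-1` `]p, q]%classic = `](p - b) / a, (q - b) / a]%classic.
  apply/seteqP; split => t /=; rewrite !in_itv /= /F => /andP[pt tq];
    move: pt tq; rewrite ltr_pdivrMr// ler_pdivlMr// ltrBlDr lerBrDr [t * a]mulrC.
  by move=> -> ->.
  by move=> -> ->.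
rewrite !lebesgue_measure_itv /= !lte_fin ltr_pM2r ?invr_gt0// ltrD2r.
case: ifPn => // _; last by rewrite mule0.
by rewrite -!EFinD -EFinM; congr EFin; field; rewrite gt_eqF.
Qed.

(** The normal law has the same null sets as Lebesgue measure, whose null sets are preserved by
    affine maps. *)
Lemma normal_prob_affine_null (a b : R) A : 0 < a -> measurable A ->
  N01 ((fun t => a * t + b)%R @^-1` A) = 0%E -> N01 A = 0%E.
Proof.
move=> a0 mA A0; have mF : measurable_fun [set: R] (fun t : R => a * t + b).
  by apply: measurable_funD => //; apply: measurable_funM.
have mFA : measurable ((fun t : R => a * t + b) @^-1` A).
  by rewrite -[X in measurable X]setTI; exact: mF.
have /null_content_dominatesP := @normal_prob_dominates R 0 1; apply => //.
by have := lebesgue_measure_affine b a0 mA; rewrite (normal_prob_null mFA A0) mule0.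
Qed.

End null_sets.

Section product_null.
Context d1 d2 (T1 : measurableType d1) (T2 : measurableType d2) (R : realType).
Variables (m1 : {measure set T1 -> \bar R})
  (m2 : {sigma_finite_measure set T2 -> \bar R}).

Lemma product_null (A : set (T1 * T2)) : measurable A ->
  (m1 \x m2)%E A = 0%E <-> {ae m1, forall x, m2 (xsection A x) = 0%E}.
Proof.
move=> mA; have mf := @measurable_fun_xsection _ _ _ _ _ m2 _ mA.
have := @ae_eq_integral_abs _ _ _ m1 _ measurableT _ mf.
have -> : (\int[m1]_x `|(m2 \o xsection A) x| = (m1 \x m2) A)%E.
  by apply: eq_integral => x _; rewrite gee0_abs.
move=> [h1 h2]; split => [/h1|h].
  by apply: filterS => x; apply.
by apply: h2; apply: filterS h => x h _.
Qed.

End product_null.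

Section Rinfty.
Variable R : realType.
Implicit Types (A : nat -> set R) (x z : Rinfty R).

Lemma measurable_coord k : measurable_fun [set: Rinfty R] (fun x => x k : R).
Proof.
by move=> _ B mB; rewrite setTI; apply: sub_sigma_algebra; exists k, B.
Qed.

Lemma measurable_Rinfty d (T : measurableType d) (f : T -> Rinfty R) :
  (forall k, measurable_fun [set: T] (fun t => f t k : R)) -> measurable_fun [set: T] f.
Proof.
move=> mf; apply: (@measurability _ _ T (Rinfty R) _ f (@cylinders R)) => //.
move=> _ [_ [k [B [mB ->]]] <-].
exact: (mf k measurableT B mB).
Qed.

Lemma measurable_coord_comp d (T : measurableType d) (f : T -> Rinfty R) k :
  measurable_fun [set: T] f -> measurable_fun [set: T] (fun t => f t k : R).
Proof. by move=> mf; exact: (measurableT_comp (measurable_coord k) mf). Qed.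

Definition box A : set (Rinfty R) := [set x | forall k, A k (x k)].

Definition fin_box n A :=
  (forall k, measurable (A k)) /\ forall k, (n <= k)%N -> A k = setT.

Lemma fin_boxW m n A : (m <= n)%N -> fin_box m A -> fin_box n A.
Proof. by move=> mn [mA AT]; split => // k nk; apply/AT/(leq_trans mn). Qed.

Lemma boxE n A : fin_box n A ->
  box A = [set x | forall k, (k < n)%N -> A k (x k)].
Proof.
move=> [_ AT]; apply/seteqP; split => x /= xA k; first by move=> _; exact: xA.
by have [nk|kn] := leqP n k; [rewrite AT|exact: xA].
Qed.

Lemma measurable_box A : (forall k, measurable (A k)) -> measurable (box A).
Proof.
move=> mA; rewrite (_ : box A = \bigcap_k ((fun x : Rinfty R => x k) @^-1` A k)).
  by apply: bigcapT_measurable => k; rewrite -[X in measurable X]setTI; exact: measurable_coord.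
by apply/seteqP; split => x /= xA k; [move=> _; exact: xA|exact: (xA k I)].
Qed.

(** A box over few coordinates is also a box over more. The threshold [n0] thus costs nothing, and
    it serves maps that involve a fixed number of coordinates. *)
Lemma Rinfty_measure_unique (P : {measure set (Rinfty R) -> \bar R})
    (Q : probability (Rinfty R) R) n0 :
  (forall n A, (n0 <= n)%N -> fin_box n A -> P (box A) = Q (box A)) ->
  forall F, measurable F -> P F = Q F.
Proof.
move=> PQ F mF; apply/esym.
pose G : set (set (Rinfty R)) := [set B | exists A n, fin_box n A /\ B = box A].
have boxT : box (fun=> setT) = setT by apply/seteqP; split.
apply: (measure_unique G (fun=> setT)) => //.
- apply/seteqP; split.
    apply: smallest_sub; first exact: smallest_sigma_algebra.
    move=> _ [k [B [mB ->]]]; apply: sub_sigma_algebra.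
    exists (fun j => if j == k then B else setT), k.+1; split.
      by split=> [j|j kj]; [case: ifP|rewrite gtn_eqF].
    apply/seteqP; split => x /=; first by move=> Bx j; case: eqP => // ->.
    by move=> /(_ k); rewrite eqxx.
  apply: smallest_sub; first exact: sigma_algebra_measurable.
  by move=> _ [A [n [[mA _] ->]]]; exact: measurable_box.
- move=> _ _ [A [n [[mA An] ->]]] [B [m [[mB Bm] ->]]].
  exists (fun k => A k `&` B k), (maxn n m); split.
    split=> [k|k]; first exact: measurableI.
    by rewrite geq_max => /andP[nk mk]; rewrite An// Bm// setTI.
  by apply/seteqP; split => x /= => [[xA xB] k|xAB]; [split|split => k; case: (xAB k)].
- by move=> _; exists (fun=> setT), 0%N; split => //; rewrite boxT.
- by rewrite bigcup_const//; exists 0%N.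
- move=> _ [A [n [An ->]]]; apply/esym/(PQ (maxn n0 n)); first exact: leq_maxl.
  exact: fin_boxW (leq_maxr _ _) An.
- by move=> _; rewrite -ge0_fin_numE//; exact: fin_num_measure.
Qed.

Definition upd i (x : Rinfty R) (t : R) : Rinfty R := fun k => if k == i then t else x k.

Lemma measurable_upd i :
  measurable_fun [set: Rinfty R * R] (fun p => upd i p.1 p.2).
Proof.
apply: measurable_Rinfty => k; rewrite /upd; case: (k == i); first exact: measurable_snd.
exact: measurable_coord_comp measurable_fst.
Qed.

Definition interleave n (p : Rinfty R * Rinfty R) : Rinfty R :=
  fun k => if (k < n)%N then p.1 k else p.2 (k - n)%N.

Lemma measurable_interleave n :
  measurable_fun [set: Rinfty R * Rinfty R] (interleave n).
Proof.
apply: measurable_Rinfty => k; rewrite /interleave; case: (k < n)%N.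
  exact: measurable_coord_comp measurable_fst.
exact: measurable_coord_comp measurable_snd.
Qed.

End Rinfty.

Section gaussian.
Context (R : realType) (mu : probability (Rinfty R) R).
Hypothesis gmu : is_gaussian_product mu.
Local Notation N01 := (@normal_prob R 0 1).

Lemma gaussian_box n A : fin_box n A -> mu (box A) = (\prod_(k < n) N01 (A k))%E.
Proof. by move=> An; rewrite (boxE An) gmu//; case: An. Qed.

(** The coordinates from [n] on are independent of the earlier ones and have joint law [mu] again;
    on boxes the product over coordinates splits in two. *)
Lemma gaussian_interleave n (F : set (Rinfty R)) : measurable F ->
  (mu \x mu)%E (interleave n @^-1` F) = mu F.
Proof.
have [P PE] := pushforward_measure (mu \x mu)%E (measurable_interleave (R := R) n).
move=> mF; rewrite -PE; apply: (@Rinfty_measure_unique R P mu n) => // N A nN AN.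
have [mA AT] := AN; rewrite PE.
pose B k := if (k < n)%N then A k else setT.
pose C k := A (n + k)%N.
have Bn : fin_box n B.
  by rewrite /B; split => [k|k nk]; [case: ifP|rewrite ltnNge nk].
have Cn : fin_box (N - n) C.
  by split => [k|k Nk]; [exact: mA|apply: AT; rewrite -leq_subLR].
have -> : interleave n @^-1` box A = box B `*` box C.
  apply/seteqP; split => [[x z]|[x z]] /=.
    move=> h; split => k.
      by rewrite /B; have := h k; rewrite /interleave; case: ifP.
    have := h (n + k)%N; rewrite /interleave ltnNge leq_addr /=.
    by rewrite addKn.
  move=> [hx hz] k; rewrite /interleave; case: ltnP => kn.
    by have := hx k; rewrite /B kn.
  by have := hz (k - n)%N; rewrite /C subnKC.
transitivity (mu (box B) * mu (box C))%E.
  by apply: product_measure1E; apply: measurable_box; [exact: Bn.1|exact: Cn.1].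
rewrite (gaussian_box Bn) (gaussian_box Cn) (gaussian_box AN).
rewrite -(subnKC nN) big_split_ord /=; congr (_ * _)%E.
  by apply: eq_bigr => k _; rewrite /B ltn_ord.
by rewrite addKn.
Qed.

(** Replacing coordinate [i] by an independent normal variable does not change the law. *)
Lemma gaussian_resample i (F : set (Rinfty R)) : measurable F ->
  (mu \x N01)%E ((fun p => upd i p.1 p.2) @^-1` F) = mu F.
Proof.
have [P PE] := pushforward_measure (mu \x N01)%E (measurable_upd (R := R) i).
move=> mF; rewrite -PE; apply: (@Rinfty_measure_unique R P mu i.+1) => // N A iN AN.
have [mA AT] := AN; rewrite PE.
pose B k := if k == i then setT else A k.
have Bn : fin_box N B.
  by rewrite /B; split => [k|k nk]; case: ifP => // _; exact: AT.
have -> : (fun p => upd i p.1 p.2) @^-1` box A = box B `*` A i.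
  apply/seteqP; split => [[x t]|[x t]] /=.
    move=> h; split=> [k|]; last by have := h i; rewrite /upd eqxx.
    by rewrite /B; have := h k; rewrite /upd; case: ifP.
  move=> [hx ht] k; rewrite /upd; case: eqP => [->//|/eqP ki].
  by have := hx k; rewrite /B (negbTE ki).
transitivity (mu (box B) * N01 (A i))%E.
  by apply: product_measure1E; [apply: measurable_box; exact: Bn.1|exact: mA].
rewrite (gaussian_box Bn) (gaussian_box AN).
rewrite (bigD1 (Ordinal iN))//= [in RHS](bigD1 (Ordinal iN))//=.
rewrite /B eqxx probability_setT mul1e muleC; congr (_ * _)%E.
apply: eq_bigr => k ki; case: eqP => // kE.
by rewrite -val_eqE /= kE eqxx in ki.
Qed.

(** After resampling coordinate [i], Fubini reduces the claim to [normal_prob_affine_null] on almost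
    every line in direction [i]. *)
Lemma gaussian_affine_null (i : nat) (a b : R) (F : set (Rinfty R)) : 0 < a -> measurable F ->
  mu ((fun x => upd i x (a * x i + b)) @^-1` F) = 0%E -> mu F = 0%E.
Proof.
move=> a0 mF; pose T (x : Rinfty R) : Rinfty R := upd i x (a * x i + b).
rewrite -[X in X @^-1` _]/T.
have mT : measurable_fun setT T.
  apply: measurable_Rinfty => k; rewrite /T /upd; case: (k == i); last exact: measurable_coord.
  by apply: measurable_funD => //; apply: measurable_funM => //; exact: measurable_coord.
have mpre H : measurable H -> measurable ((fun p : Rinfty R * R => upd i p.1 p.2) @^-1` H).
  by move=> mH; rewrite -[X in measurable X]setTI; exact: measurable_upd.
have mTF : measurable (T @^-1` F) by rewrite -[X in measurable X]setTI; exact: mT.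
rewrite -(gaussian_resample i mTF) -(gaussian_resample i mF).
have [h _] := product_null mu N01 (mpre _ mTF); have [_ h'] := product_null mu N01 (mpre _ mF).
move=> /h {}h; apply: h'.
apply: filterS h => x h; apply: (normal_prob_affine_null (b := b) a0).
  exact: measurable_xsection (mpre _ mF).
rewrite -[RHS]h; congr (normal_prob _ _ _); apply/seteqP.
have TE t : T (upd i x t) = upd i x (a * t + b).
  by apply/funext => k; rewrite /T /upd eqxx; case: eqP.
by split => t /=; rewrite /xsection /= !in_setE /= TE.
Qed.

End gaussian.

(** * Square integrability of the normal law *)

Section second_moment.
Variable R : realType.
Local Notation leb := (@lebesgue_measure R).
Local Notation N01 := (@normal_prob R 0 1).

(** Change of variables is known for the Radon-Nikodym derivative, which agrees with the normal
    density almost everywhere since both have the same integrals. *)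
Lemma ge0_integral_normal_prob (f : R -> \bar R) : (forall t, 0 <= f t)%E ->
  measurable_fun [set: R] f ->
  (\int[N01]_t f t = \int[leb]_t (f t * (normal_pdf 0 1 t)%:E))%E.
Proof.
move=> f0 mf.
rewrite -(Radon_Nikodym_SigmaFinite.change_of_variables (normal_prob_dominates 0 1) f0)//.
have mpdf : measurable_fun [set: R] (EFin \o normal_pdf (0 : R) 1).
  by apply/measurable_EFinP; exact: measurable_normal_pdf.
have iRN := Radon_Nikodym_SigmaFinite.f_integrable (normal_prob_dominates (0 : R) 1).
have mRN := measurable_int _ iRN.
apply: ae_eq_integral => //; [exact: emeasurable_funM|exact: emeasurable_funM|].
apply: ae_eqe_mul2l; apply: integral_ae_eq => //.
by move=> E _ mE; rewrite -Radon_Nikodym_SigmaFinite.f_integral//; exact: normal_prob_dominates.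
Qed.

Lemma normal_prob_sqr_lty : (\int[N01]_t (t ^+ 2)%:E < +oo)%E.
Proof.
have msqr : measurable_fun [set: R] (fun t => (t ^+ 2)%:E).
  by apply/measurable_EFinP; exact: measurable_funX.
rewrite ge0_integral_normal_prob//; last by move=> t; rewrite lee_fin sqr_ge0.
have p1 : 0 < normal_peak (1 : R) by rewrite normal_peak_gt0// oner_neq0.
have p2 : 0 < normal_peak (2 : R) by rewrite normal_peak_gt0.
(* The integrand is compared with the normal density of standard deviation 2: the ratio of peaks
   exchanges the normalizations, and 4 absorbs the square. *)
pose K : R := 4 * normal_peak 1 / normal_peak 2.
have K0 : 0 <= K by rewrite /K divr_ge0 ?mulr_ge0 ?ltW.
apply: (@le_lt_trans _ _ (\int[leb]_t (K%:E * (normal_pdf 0 2 t)%:E))%E); last first.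
  rewrite ge0_integralZl//; last 2 first.
  - by apply/measurable_EFinP; exact: measurable_normal_pdf.
  - by move=> t _; rewrite lee_fin normal_pdf_ge0.
  by rewrite integral_normal_pdf mule1 ltry.
apply: ge0_le_integral => //.
- by move=> t _; rewrite mule_ge0 ?lee_fin ?sqr_ge0 ?normal_pdf_ge0.
- apply: emeasurable_funM => //.
  by apply/measurable_EFinP; exact: measurable_normal_pdf.
- apply: emeasurable_funM => //.
  by apply/measurable_EFinP; exact: measurable_normal_pdf.
move=> t _; rewrite -!EFinM lee_fin /normal_pdf (negbTE (oner_neq0 R)) pnatr_eq0 /=.
rewrite /normal_fun !subr0.
have -> : K * (normal_peak 2 * expR (- t ^+ 2 / (2 ^+ 2 *+ 2))) =
    normal_peak 1 * (4 * expR (- t ^+ 2 / (2 ^+ 2 *+ 2))).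
  by rewrite /K; field; rewrite gt_eqF.
rewrite mulrCA ler_pM2l//.
(* It remains to see t^2 <= 4 exp(u), for u = 3 t^2 / 8, and exp(u) >= 1 + u. *)
have -> : expR (- t ^+ 2 / (2 ^+ 2 *+ 2)) =
    expR (3 / 8 * t ^+ 2) * expR (- t ^+ 2 / (1 ^+ 2 *+ 2)).
  by rewrite -expRD; congr expR; field.
rewrite mulrA ler_pM2r ?expR_gt0//.
have := expR_ge1Dx (3 / 8 * t ^+ 2); have := sqr_ge0 t; set u := t ^+ 2; lra.
Qed.

End second_moment.

Section coordinates.
Context (R : realType) (mu : probability (Rinfty R) R).
Hypothesis gmu : is_gaussian_product mu.
Local Notation N01 := (@normal_prob R 0 1).

Lemma gaussian_coord k (B : set R) : measurable B ->
  mu ((fun x => x k) @^-1` B) = N01 B.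
Proof.
move=> mB; pose A j := if j == k then B else setT.
have Ak : fin_box k.+1 A.
  by rewrite /A; split => [j|j kj]; [case: ifP|rewrite gtn_eqF].
rewrite (_ : _ @^-1` B = box A); last first.
  apply/seteqP; split => x /=; first by move=> Bx j; rewrite /A; case: eqP => // ->.
  by move=> /(_ k); rewrite /A eqxx.
rewrite (gaussian_box gmu Ak) (bigD1 (ord_max : 'I_k.+1))//= /A eqxx big1 ?mule1//.
move=> j jk; rewrite ifF ?probability_setT//; apply/negbTE.
by apply: contra jk => /eqP jk; apply/eqP/val_inj.
Qed.

Lemma coord_Lfun k : (fun x : Rinfty R => x k) \in Lfun mu 2%:E.
Proof.
apply/andP; split; rewrite inE /=; first exact: measurable_coord.
rewrite /finite_norm; apply: (@lty_poweRy _ _ 2); first by [].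
rewrite poweR_Lnorm ?pnatr_eq0//.
apply: le_lt_trans (@normal_prob_sqr_lty R).
have msqr : measurable_fun [set: R] (fun t => (t ^+ 2)%:E).
  by apply/measurable_EFinP; exact: measurable_funX.
have sqr0 : {in [set: R], forall t, (0 <= (t ^+ 2)%:E)%E}.
  by move=> t _; rewrite lee_fin sqr_ge0.
have E := @ge0_integral_pushforward _ _ _ (measurableTypeR R) R _ (@measurable_coord R k) mu
  _ _ measurableT msqr sqr0.
have [P PE] := @pushforward_measure _ _ _ (measurableTypeR R) _ mu _ (measurable_coord (R := R) k).
have PN : (\int[P]_t (t ^+ 2)%:E = \int[N01]_t (t ^+ 2)%:E)%E.
  by apply: eq_measure_integral => B mB _; rewrite PE; exact: gaussian_coord.
have PP : pushforward mu (fun x : Rinfty R => x k) = P by apply/funext => B; rewrite PE.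
rewrite -PN -PP.
rewrite le_eqVlt; apply/orP; left; apply/eqP.
etransitivity; last exact: esym E.
rewrite preimage_setT; apply: eq_integral => x _ /=.
by rewrite powR_mulrn// real_normK ?num_real.
Qed.

End coordinates.

(** * Whirliness of the Gaussian near-action *)

Section rotation.
Context (R : realType) (n : nat).
Implicit Types (c d : l2 R) (C S : nat -> R).

(* The rotation of the plane of e_k and e_(n + k) with cosine C k and sine S k,
   for all k < n at once. *)
Definition rot_seq C S (c : nat -> R) : nat -> R := fun k =>
  if (k < n)%N then C k * c k - S k * c (n + k)%N
  else if (k < n + n)%N then S (k - n)%N * c (k - n)%N + C (k - n)%N * c k
  else c k.

(** Coordinates k and n+k rotate in their own plane, which preserves the sum of their squares; from
    2n on nothing changes. *)
Lemma sum_rot_seq C S (c : nat -> R) N : (forall k, C k ^+ 2 + S k ^+ 2 = 1) ->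
  \sum_(0 <= k < n + n + N) rot_seq C S c k * rot_seq C S c k =
  \sum_(0 <= k < n + n + N) c k * c k.
Proof.
move=> CS; rewrite !(@big_cat_nat _ _ _ (n + n) 0 (n + n + N))//= ?leq_addr//; congr (_ + _).
  rewrite !(@big_cat_nat _ _ _ n 0 (n + n))//= ?leq_addr// -{2 6}[n]add0n !big_addn addnK.
  rewrite -!big_split /= !big_nat; apply: eq_bigr => k /andP[_ kn].
  rewrite /rot_seq kn ltnNge leq_addl /= ltn_add2r kn addnK [(k + n)%N]addnC.
  transitivity ((C k ^+ 2 + S k ^+ 2) * (c k * c k + c (n + k)%N * c (n + k)%N)); first by ring.
  by rewrite CS mul1r.
rewrite big_nat [RHS]big_nat; apply: eq_bigr => k /andP[nk _].
by rewrite /rot_seq ltnNge (leq_trans (leq_addr _ _) nk) /= ltnNge nk.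
Qed.

Lemma sum_rot_seq_le C S c N : (forall k, C k ^+ 2 + S k ^+ 2 = 1) ->
  \sum_(0 <= k < N) rot_seq C S c k * rot_seq C S c k <= `|c| ^+ 2.
Proof.
move=> CS; apply: le_trans (l2_sum_le c (n + n + N)); rewrite -(sum_rot_seq c N CS).
rewrite [in leRHS]addnC [leRHS](@big_cat_nat _ _ _ N)//= ?leq_addr// lerDl.
by apply: sumr_ge0 => k _; rewrite -expr2 sqr_ge0.
Qed.

Lemma rot_seqK C S (c : nat -> R) : (forall k, C k ^+ 2 + S k ^+ 2 = 1) ->
  rot_seq C (fun k => - S k) (rot_seq C S c) = c.
Proof.
move=> CS; apply/funext => k; rewrite {1}/rot_seq; case: ltnP => kn.
  rewrite /rot_seq kn [(n + k < n)%N]ltnNge leq_addr /= ltn_add2l kn addKn.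
  transitivity ((C k ^+ 2 + S k ^+ 2) * c k); first by ring.
  by rewrite CS mul1r.
case: ltnP => knn.
  have kn' : (k - n < n)%N by rewrite ltn_subLR.
  rewrite /rot_seq kn' [(k < n)%N]ltnNge kn /= knn subnKC//.
  transitivity ((C (k - n)%N ^+ 2 + S (k - n)%N ^+ 2) * c k); first by ring.
  by rewrite CS mul1r.
by rewrite /rot_seq ltnNge kn /= ltnNge knn.
Qed.

Lemma rotation_exists C S : (forall k, C k ^+ 2 + S k ^+ 2 = 1) ->
  exists r : Ol2 R, forall c, r c = rot_seq C S c :> (nat -> R).
Proof.
move=> CS; have CS' k : C k ^+ 2 + (- S k) ^+ 2 = 1 by rewrite sqrrN.
have /choice[r rE] : forall c, exists c' : l2 R, (c' : nat -> R) = rot_seq C S c.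
  by move=> c; apply: l2_exists (fun N => sum_rot_seq_le c N CS).
have /choice[r' r'E] : forall c, exists c' : l2 R,
    (c' : nat -> R) = rot_seq C (fun k => - S k) c.
  by move=> c; apply: l2_exists (fun N => sum_rot_seq_le c N CS').
have rK : cancel r r'.
  by move=> c; apply: l2_eq => k; rewrite r'E rE rot_seqK.
have r'K : cancel r' r.
  move=> c; apply: l2_eq => k; rewrite rE r'E.
  have := @rot_seqK C (fun k => - S k) c CS'.
  rewrite (_ : (fun k => - - S k) = S); last by apply/funext => i; rewrite opprK.
  by move=> ->.
have rlin : linear r.
  move=> a c d; apply: l2_eq => k; rewrite rE l2DE l2ZE !rE /rot_seq.
  rewrite !l2DE !l2ZE.
  by case: ifP => _; [ring|case: ifP => _ //; ring].
have rbij : bijective r by exists r'.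
(* Neither the rotation nor the one by opposite angles increases the norm, and they are mutually
   inverse. *)
have rnorm c : `|r c| = `|c|.
  apply/eqP; rewrite eq_le; apply/andP; split.
    by apply: l2_norm_le => // N; rewrite rE; exact: sum_rot_seq_le.
  rewrite -{1}(rK c); apply: l2_norm_le => // N; rewrite r'E; exact: sum_rot_seq_le.
have rdot c d : l2dot (r c) (r d) = l2dot c d.
  by rewrite !l2dotE !rnorm -[r c]scale1r -rlin rnorm scale1r.
by exists (OrthogonalOperator rlin rbij rdot).
Qed.

Lemma rot_delta C S (r : Ol2 R) i : (forall c, r c = rot_seq C S c :> (nat -> R)) ->
  (i < n)%N -> r (l2_delta R i) = C i *: l2_delta R i + S i *: l2_delta R (n + i).
Proof.
move=> rE ni; apply: l2_eq => k; rewrite rE l2DE !l2ZE /rot_seq !l2_deltaE.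
case: ltnP => kn.
  rewrite [(k == (n + i)%N)]ltn_eqF ?(leq_trans kn (leq_addr _ _))//.
  rewrite [(n + k == i)%N]gtn_eqF ?(leq_trans ni (leq_addr _ _))//.
  by rewrite /= !mulr0 subr0 addr0; case: eqP => [->|_]; rewrite ?mulr0.
rewrite [(k == i)%N]gtn_eqF ?(leq_trans ni)//.
case: ltnP => knn.
  have -> : (k == n + i)%N = (k - n == i)%N by apply/eqP/eqP; lia.
  by rewrite /= !mulr0 addr0 add0r; case: eqP => [<-|_]; rewrite ?mulr0.
rewrite gtn_eqF; first by rewrite /= !mulr0 addr0.
by rewrite (leq_trans _ knn)// ltn_add2l.
Qed.

End rotation.

Section zeta.
Context (R : realType) (mu : probability (Rinfty R) R).
Hypothesis gmu : is_gaussian_product mu.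

(** The vector has finite support, so once [n] exceeds [i] and [j] the partial sum is the function
    itself. The case i = j is included. *)
Lemma zeta_version_delta2 i j (a b : R) :
  zeta_version mu (a *: l2_delta R i + b *: l2_delta R j) (fun x => a * x i + b * x j).
Proof.
split.
  have -> : (fun x : Rinfty R => a * x i + b * x j) =
      a *: (fun x : Rinfty R => x i) + b *: (fun x : Rinfty R => x j).
    by apply/funext.
  have l12 : (1 <= 2%:E :> \bar R)%E by exact: lee1n.
  have [_ cl] := @Lfun_submod_closed _ _ R mu 2%:E l12.
  apply: (cl); first exact: coord_Lfun.
  rewrite -[X in X \in _]addr0; apply: (cl); first exact: coord_Lfun.
  exact: (Lfun_submod_closed mu l12).1.
apply: cvg_near_cst; exists (maxn i j).+1 => // n /=; rewrite gtn_max => /andP[ni nj].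
rewrite (_ : (fun x => _) = cst 0%E) ?Lnorm0 ?pnatr_eq0//.
apply/funext => x /=; congr EFin; apply/eqP; rewrite subr_eq0; apply/eqP.
transitivity (\sum_(k < n) (a * (nat_of_ord k == i)%:R * x k + b * (nat_of_ord k == j)%:R * x k)); last first.
  apply: eq_bigr => k _; rewrite -mulrDl; congr (_ * _).
  by rewrite -[RHS]/(a * l2_delta R i k + b * l2_delta R j k) !l2_deltaE.
have pick m (e : R) : (m < n)%N -> \sum_(k < n) e * (nat_of_ord k == m)%:R * x k = e * x m.
  move=> mn; rewrite (bigD1 (Ordinal mn))//= eqxx mulr1 big1 ?addr0// => k km.
  by rewrite [(nat_of_ord k == m)](negbTE km) mulr0 mul0r.
by rewrite big_split /= !pick.
Qed.

End zeta.

(** * Comparison of measures, and approximation by cylinder sets *)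

Section measure_lemmas.
Context d (T : measurableType d) (R : realType) (mu : {measure set T -> \bar R}).
Implicit Types A B D : set T.

Lemma le_measureU2 A B D : measurable A -> measurable B -> measurable D ->
  A `<=` B `|` D -> (mu A <= mu B + mu D)%E.
Proof.
move=> mA mB mD ABD; apply: le_trans (measureU2 mu mB mD).
by apply: le_measure => //; rewrite inE//; exact: measurableU.
Qed.

Lemma measure_ae_le A B : measurable A -> measurable B ->
  {ae mu, forall x, A x -> B x} -> (mu A <= mu B)%E.
Proof.
move=> mA mB [N [mN N0 sN]]; rewrite -[leRHS]adde0 -N0; apply: le_measureU2 => // x Ax.
by have [Bx|nBx] := pselect (B x); [left|right; apply: sN => /= /(_ Ax)].
Qed.

Lemma measure_ae_eq A B : measurable A -> measurable B ->
  {ae mu, forall x, A x <-> B x} -> mu A = mu B.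
Proof.
move=> mA mB AB; apply/eqP; rewrite eq_le; apply/andP; split;
  by apply: measure_ae_le => //; apply: filterS AB => x [].
Qed.

Definition symdiff A B := (A `\` B) `|` (B `\` A).

Lemma measurable_symdiff A B : measurable A -> measurable B -> measurable (symdiff A B).
Proof. by move=> mA mB; apply: measurableU; exact: measurableD. Qed.

End measure_lemmas.

Section cylinder_approximation.
Context (R : realType) (mu : probability (Rinfty R) R).
Implicit Types A B D : set (Rinfty R).

Definition cylinder n D := measurable D /\
  forall x y : Rinfty R, (forall k, (k < n)%N -> x k = y k) -> D x -> D y.

Lemma cylinderW m n D : (m <= n)%N -> cylinder m D -> cylinder n D.
Proof.
move=> mn [mD Dm]; split => // x y xy; apply: Dm => k km.
exact/xy/(leq_trans km).
Qed.

Lemma cylinderC n D : cylinder n D -> cylinder n (~` D).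
Proof.
move=> [mD Dn]; split; first exact: measurableC.
by move=> x y xy nDx Dy; apply: nDx; apply: Dn Dy => k kn; rewrite xy.
Qed.

Lemma cylinderU n A B : cylinder n A -> cylinder n B -> cylinder n (A `|` B).
Proof.
move=> [mA An] [mB Bn]; split; first exact: measurableU.
by move=> x y xy [Ax|Bx]; [left; exact: An Ax|right; exact: Bn Bx].
Qed.

Lemma cylinder_box n (A : nat -> set R) : fin_box n A -> cylinder n (box A).
Proof.
move=> [mA AT]; split; first exact: measurable_box.
move=> x y xy xA k; have [nk|kn] := leqP n k; first by rewrite AT.
by rewrite -xy//; exact: xA.
Qed.

Definition approximable A := measurable A /\ forall e : R, 0 < e ->
  exists n D, cylinder n D /\ (mu (symdiff A D) <= e%:E)%E.

Lemma approximableU A B : approximable A -> approximable B -> approximable (A `|` B).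
Proof.
move=> [mA aA] [mB aB]; split; first exact: measurableU.
move=> e e0; have e20 : 0 < e / 2 by rewrite divr_gt0.
have [n [D [Dn AD]]] := aA _ e20; have [m [E [Em BE]]] := aB _ e20.
exists (maxn n m), (D `|` E); split.
  by apply: cylinderU; [exact: cylinderW (leq_maxl _ _) Dn|exact: cylinderW (leq_maxr _ _) Em].
have mD := Dn.1; have mE := Em.1.
rewrite [e]splitr EFinD; apply: le_trans (leeD AD BE).
apply: le_measureU2; [|exact: measurable_symdiff..|].
  by apply: measurable_symdiff; exact: measurableU.
rewrite /symdiff => x /=; tauto.
Qed.

(** Approximable sets form a sigma-algebra that contains the generators. A countable union is first
    cut down to a finite one, up to e/2. *)
Lemma measurable_approximable A : measurable A -> approximable A.
Proof.
apply: smallest_sub => [|_ [k [B [mB ->]]]]; last first.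
  have mA : measurable [set x : Rinfty R | B (x k)].
    by apply: sub_sigma_algebra; exists k, B.
  split => // e e0; exists k.+1, [set x | B (x k)]; split.
    by split => // x y xy /=; rewrite xy.
  by rewrite /symdiff setDv setU0 measure0 lee_fin ltW.
split.
- split => // e e0; exists 0%N, set0; split; first by split.
  by rewrite /symdiff setDv setU0 measure0 lee_fin ltW.
- move=> B [mB aB]; rewrite setTD; split; first exact: measurableC.
  move=> e e0; have [n [D [Dn BD]]] := aB _ e0.
  exists n, (~` D); split; first exact: cylinderC.
  rewrite (_ : symdiff _ _ = symdiff (T := Rinfty R) B D)//; apply/seteqP; rewrite /symdiff.
  split=> x /= [[h1 h2]|[h1 h2]].
  + by right; split => //; exact: contrapT.
  + by left; split => //; exact: contrapT.
  + by right; split => //; exact/contrapT.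
  + by left; split.
- move=> F0; pose F : (set (Rinfty R))^nat := F0; rewrite -/F => aF; have mF n : measurable (F n) by exact: (aF n).1.
  have mUF : measurable (\bigcup_n F n) by exact: bigcupT_measurable.
  split => // e e0; have e20 : 0 < e / 2 by rewrite divr_gt0.
  pose G n := \big[setU/set0]_(k < n) F k.
  have mG n : measurable (G n) by exact: bigsetU_measurable.
  have aG n : approximable (G n).
    rewrite /G; elim: n => [|n ih].
      rewrite big_ord0; split => // r r0; exists 0%N, set0; split; first by split.
      by rewrite /symdiff setDv setU0 measure0 lee_fin ltW.
    by rewrite big_ord_recr /=; exact: approximableU.
  (* The remainders decrease to the empty set, so their measures tend to 0. *)
  have [N tN] : exists N, (mu (\bigcup_n F n `\` G N) <= (e / 2)%:E)%E.
    have : mu (\bigcup_n F n `\` G n) @[n --> \oo] --> mu (\bigcap_n (\bigcup_n F n `\` G n)).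
      apply: nonincreasing_cvg_mu.
      - by rewrite -ge0_fin_numE//; exact: fin_num_measure (measurableD mUF (mG 0%N)).
      - by move=> n; exact: measurableD.
      - by apply: bigcapT_measurable => n; exact: measurableD.
      - move=> n m nm; apply/subsetPset => x [Ux nGm]; split => // Gn; apply: nGm.
        move: Gn; rewrite /G -!bigcup_mkord => -[k /= kn Fk]; exists k => //=.
        exact: leq_trans kn nm.
    rewrite (_ : \bigcap_n _ = set0); last first.
      apply/seteqP; split => // x h; have [[k _ Fk] _] := h 0%N I.
      have [_] := h k.+1 I; apply; rewrite /G -bigcup_mkord; exists k => //=.
    rewrite measure0 => /fine_cvgP[+ /cvgrPdist_le/(_ _ e20)].
    move=> [N1 _ fN1] [N2 _ N2e]; exists (maxn N1 N2).
    have := N2e (maxn N1 N2) (leq_maxr _ _); rewrite /= sub0r normrN => h.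
    rewrite -(@fineK _ (mu _)) ?lee_fin; last exact: fN1 (leq_maxl _ _).
    exact: le_trans (ler_norm _) h.
  have [n [D [Dn GD]]] := (aG N).2 _ e20.
  have mD := Dn.1; exists n, D; split => //.
  rewrite [e]splitr EFinD; apply: le_trans (leeD tN GD).
  apply: le_measureU2; [exact: measurable_symdiff|exact: measurableD|exact: measurable_symdiff|].
  move=> x [[Fx nDx]|[Dx nFx]].
    by have [Gx|nGx] := pselect (G N x); [right; left|left].
  right; right; split => // Gx; apply: nFx.
  by move: Gx; rewrite /G -bigcup_mkord => -[k _ Fk]; exists k.
Qed.

End cylinder_approximation.

(** Rational parametrization of the circle, with [t] the tangent of half the angle; the left-hand
    side is (2t^2 + 2t)/(1 + t^2), at most 4t < e since t <= 1 and 5t < e. *)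
Lemma small_rotation (R : realType) (e : R) : 0 < e -> exists C S : R,
  [/\ 0 < S, C ^+ 2 + S ^+ 2 = 1 & `|C - 1| + `|S| < e].
Proof.
move=> e0; have [m [_ me]] := invS_lt_exists 0 (divr_gt0 e0 (ltr0n R 5)).
set t : R := m.+1%:R^-1 in me.
have t0 : 0 < t by rewrite invr_gt0.
have t1 : t <= 1 by rewrite invf_le1// ler1n.
have d0 : 0 < 1 + t ^+ 2 by rewrite ltr_wpDr ?sqr_ge0.
exists ((1 - t ^+ 2) / (1 + t ^+ 2)), (2 * t / (1 + t ^+ 2)); split.
- by rewrite divr_gt0// mulr_gt0.
- by field; rewrite gt_eqF.
have -> : (1 - t ^+ 2) / (1 + t ^+ 2) - 1 = - (2 * t ^+ 2 / (1 + t ^+ 2)).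
  by field; rewrite gt_eqF.
rewrite normrN !ger0_norm ?divr_ge0 ?mulr_ge0 ?sqr_ge0 ?ltW//.
rewrite -mulrDl ltr_pdivrMr//.
have tt : t ^+ 2 <= t by rewrite expr2 ler_piMl// ltW.
have := sqr_ge0 t; move: me tt t0 e0; set u := t ^+ 2; move=> me tt t0 e0 u0.
have : 0 <= e * u by rewrite mulr_ge0// ltW.
lra.
Qed.

Section gaussian_action.
Context (R : realType) (mu : probability (Rinfty R) R)
  (act : Ol2 R -> Rinfty R -> Rinfty R).
Hypotheses (gmu : is_gaussian_product mu) (gact : gaussian_near_action mu act).
Local Notation mu2 := (mu \x mu)%E.
Implicit Types A D F : set (Rinfty R).

Lemma measurable_act g F : measurable F -> measurable (act g @^-1` F).
Proof.
move=> mF; have [[mact _ _ _] _] := gact; rewrite -[X in measurable X]setTI.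
have mg : measurable_fun setT (fun x => (g : borel (Ol2 R), x) : borel (Ol2 R) * Rinfty R).
  exact: pair1_measurable.
exact: (measurableT_comp mact mg) measurableT _ mF.
Qed.

Section mix.
Variables (m : nat) (C0 S0 : R).
Hypotheses (S0_gt0 : 0 < S0) (CS0 : C0 ^+ 2 + S0 ^+ 2 = 1).

Let C k := if (k < m)%N then C0 else 0.
Let S k := if (k < m)%N then S0 else 1.

Let CS k : C k ^+ 2 + S k ^+ 2 = 1.
Proof. by rewrite /C /S; case: ifP => // _; rewrite expr0n expr1n add0r. Qed.

(* shift n y is mix (x, z) when (x, z) are the coordinates of y before and from n.
   In the limit of large n, mix (x, z) is thus the image of x under a rotation. *)
Definition shift n (y : Rinfty R) : Rinfty R := fun k => C k * y k + S k * y (n + k)%N.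

Definition mix (p : Rinfty R * Rinfty R) : Rinfty R :=
  fun k => C k * p.1 k + S k * p.2 k.

Lemma measurable_shift n : measurable_fun [set: Rinfty R] (shift n).
Proof.
apply: measurable_Rinfty => k; apply: measurable_funD.
  by apply: measurable_funM => //; exact: measurable_coord.
by apply: measurable_funM => //; exact: measurable_coord.
Qed.

Lemma measurable_mix : measurable_fun [set: Rinfty R * Rinfty R] mix.
Proof.
apply: measurable_Rinfty => k; apply: measurable_funD.
  by apply: measurable_funM => //; exact: measurable_coord_comp measurable_fst.
by apply: measurable_funM => //; exact: measurable_coord_comp measurable_snd.
Qed.

(** The functional of [r e_k] is [C k * y k + S k * y (n + k)], and by the defining identity of the
    near-action it is also coordinate k after acting by the inverse of [r]. *)
Lemma rotation_mix n : (m <= n)%N -> exists r : Ol2 R,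
  (forall i, (i < m)%N ->
     r (l2_delta R i) - l2_delta R i = (C0 - 1) *: l2_delta R i + S0 *: l2_delta R (n + i)) /\
  {ae mu, forall y, forall k, (k < n)%N -> act r^-1%g y k = shift n y k}.
Proof.
move=> mn; have [r rE] := rotation_exists n CS; exists r; split.
  move=> i im; rewrite (rot_delta rE (leq_trans im mn)) /C /S im.
  by rewrite scalerBl scale1r addrAC.
apply: ae_foralln => k; have [nk|kn] := leqP n k; first exact: aeW.
have v1 := zeta_version_delta2 gmu k k 1 0.
rewrite scale1r scale0r addr0 in v1.
have v2 := zeta_version_delta2 gmu k (n + k) (C k) (S k).
rewrite -(rot_delta rE kn) in v2.
have := gact.2 r _ _ _ v1 v2; apply: filterS => y /= + _.
by rewrite mul1r mul0r addr0 /shift => <-.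
Qed.

(** [A] and [D] see only the first [n] coordinates, where the action is [shift n]; splitting a
    sequence at [n] into two independent ones turns [shift n] into [mix]. *)
Lemma act_mix n (r : Ol2 R) A D : (m <= n)%N ->
  {ae mu, forall y, forall k, (k < n)%N -> act r^-1%g y k = shift n y k} ->
  cylinder n A -> cylinder n D ->
  mu (A `&` act r^-1%g @^-1` D) = mu2 [set p | A p.1 /\ D (mix p)].
Proof.
move=> mn rE [mA An] [mD Dn].
have mW : measurable (A `&` shift n @^-1` D).
  apply: measurableI => //; rewrite -[X in measurable X]setTI.
  exact: measurable_shift.
transitivity (mu (A `&` shift n @^-1` D)).
  apply: measure_ae_eq => //; first by apply: measurableI => //; exact: measurable_act.
  apply: filterS rE => y yE; split=> -[Ay Dy]; split => //.
    by apply: Dn Dy.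
  by apply: Dn Dy => k kn; rewrite yE.
rewrite -(gaussian_interleave gmu n mW); congr mu2; apply/seteqP; split.
- move=> [x z] [/= Ax Dxz]; split.
    by apply: An Ax => k kn; rewrite /interleave kn.
  by apply: Dn Dxz => k kn; rewrite /shift /mix /interleave kn ltnNge leq_addr /= addKn.
- move=> [x z] [/= Ax Dxz]; split => /=.
    by apply: An Ax => k kn; rewrite /interleave kn.
  by apply: Dn Dxz => k kn; rewrite /shift /mix /interleave kn ltnNge leq_addr /= addKn.
Qed.

(* On cylinders this is the invariance of mu under the rotations of act_mix. *)
Lemma gaussian_mix F : measurable F -> mu2 (mix @^-1` F) = mu F.
Proof.
have [P PE] := pushforward_measure mu2 measurable_mix.
move=> mF; rewrite -PE; apply: (@Rinfty_measure_unique R P mu m) => // n A mn An.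
have [r [_ rE]] := rotation_mix mn.
have cT : cylinder n [set: Rinfty R] by split.
have cA := cylinder_box An.
have := act_mix mn rE cT cA; rewrite setTI PE.
have [[_ _ _ pact] _] := gact; rewrite (pact _ _ cA.1) => ->.
by congr mu2; apply/seteqP; split => p /= => [|[]].
Qed.

Let mixj j (x z : Rinfty R) : Rinfty R :=
  fun k => if (k < j)%N then C0 * x k + S0 * z k else z k.

(** For fixed [x], the map changes finitely many coordinates of [z], one at a time, by affine maps
    of slope [S0] > 0; each step is handled by [gaussian_affine_null]. *)
Let mixj_null j x D : measurable D -> mu (mixj j x @^-1` D) = 0%E -> mu D = 0%E.
Proof.
elim: j D => [|j ih] D mD; first by [].
move=> jD; apply: (@gaussian_affine_null _ _ gmu j S0 (C0 * x j) _ S0_gt0 mD).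
have E z : upd j (mixj j x z) (S0 * mixj j x z j + C0 * x j) = mixj j.+1 x z.
  apply/funext => k; rewrite /upd /mixj ltnn ltnS.
  have [->|kj] := eqVneq k j; first by rewrite leqnn addrC.
  by have -> : (k <= j)%N = (k < j)%N by apply/idP/idP; move/eqP: kj; lia.
apply: ih; last first.
  rewrite -[RHS]jD; congr (mu _); apply/funext => z.
  by rewrite -[RHS]/(D (mixj j.+1 x z)) -E.
rewrite -[X in measurable X]setTI.
have mT : measurable_fun [set: Rinfty R] (fun z => upd j z (S0 * z j + C0 * x j)).
  apply: measurable_Rinfty => k; rewrite /upd; case: (k == j); last exact: measurable_coord.
  by apply: measurable_funD => //; apply: measurable_funM => //; exact: measurable_coord.
exact: mT.
Qed.

Lemma mixE x z : mix (x, z) = mixj m x z.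
Proof.
apply/funext => k; rewrite /mix /mixj /C /S; case: ifP => // _.
by rewrite mul0r mul1r add0r.
Qed.

Lemma measurable_mix_set A D : measurable A -> measurable D ->
  measurable [set p : Rinfty R * Rinfty R | A p.1 /\ D (mix p)].
Proof.
move=> mA mD; apply: measurableI.
  rewrite -[X in measurable X]setTI; exact: measurable_fst.
rewrite -[X in measurable X]setTI; exact: measurable_mix.
Qed.

(** By Fubini, some [x] in [A] has a null section, and [mixj_null] for this [x] shows that [D] is
    null. *)
Lemma mix_null A D : measurable A -> measurable D ->
  mu2 [set p | A p.1 /\ D (mix p)] = 0%E -> mu A != 0%E -> mu D = 0%E.
Proof.
move=> mA mD /(product_null mu mu (measurable_mix_set mA mD)).1 h nA.
have [x [Ax xD]] : exists x, A x /\ mu (xsection [set p | A p.1 /\ D (mix p)] x) = 0%E.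
  apply: contrapT => /forallNP nx; move/eqP: nA; apply; apply/negligibleP => //.
  by apply: negligibleS h => x Ax /= xD; apply: (nx x).
apply: (@mixj_null m x D mD); rewrite -[RHS]xD; congr (mu _); apply/seteqP; split => z.
  by rewrite /xsection /= in_setE /= mixE.
by rewrite /xsection /= in_setE /= mixE => -[].
Qed.

End mix.

(** The map [mix] is independent of the number [n] of coordinates of the approximating cylinders. If
    all intersections were null, the set of [mix_null] would therefore have measure at most every e
    > 0. *)
Lemma gaussian_whirly : whirly mu act.
Proof.
move=> V A D V1 mA mD nA nD; apply: contrapT => nV.
have {}nV g : V g -> mu (A `&` act g @^-1` D) = 0%E.
  by move=> Vg; apply: contrapT => /eqP h; apply: nV; exists g.
(* The formulas for the action concern the inverse of a rotation, so it is the inverse that has to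
   lie in [V]. *)
have [m mV] : exists m, Ol2_near m 1%g `<=` [set h : Ol2 R | V h^-1%g].
  apply/nbhs_Ol2P; apply: (@invg_continuous (Ol2 R) 1%g); rewrite /= invg1.
  exact: V1.
have [C0 [S0 [S0_gt0 CS0 CSm]]] : exists C S : R,
    [/\ 0 < S, C ^+ 2 + S ^+ 2 = 1 & `|C - 1| + `|S| < m.+1%:R^-1].
  by apply: small_rotation; rewrite invr_gt0.
have mm := measurable_mix m C0 S0.
have mset := @measurable_mix_set m C0 S0.
move/eqP: nD; apply; apply: (@mix_null m C0 S0 S0_gt0 A D mA mD _ nA).
have mmix F : measurable F -> measurable (mix m C0 S0 @^-1` F).
  by move=> mF; rewrite -[X in measurable X]setTI; exact: mm.
have mfst F : measurable F -> measurable [set p : Rinfty R * Rinfty R | F p.1].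
  by move=> mF; rewrite -[X in measurable X]setTI; exact: measurable_fst.
have fstE F : measurable F -> mu2 [set p | F p.1] = mu F.
  move=> mF; rewrite (_ : [set p | F p.1] = F `*` setT); last first.
    by apply/seteqP; split => p /= => [|[]].
  transitivity (mu F * mu setT)%E; first exact: product_measure1E.
  by rewrite probability_setT mule1.
apply/eqP; rewrite eq_le measure_ge0 andbT; apply/lee_addgt0Pr => e e0; rewrite add0e.
have e40 : 0 < e / 4 by rewrite divr_gt0.
have [_ /(_ _ e40)[n1 [A' [cA' AA']]]] := measurable_approximable mu mA.
have [_ /(_ _ e40)[n2 [D' [cD' DD']]]] := measurable_approximable mu mD.
pose n := maxn m (maxn n1 n2).
have mn : (m <= n)%N by exact: leq_maxl.
have {}cA' : cylinder n A'.
  by apply: cylinderW cA'; rewrite /n leq_max leq_maxl orbT.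
have {}cD' : cylinder n D'.
  by apply: cylinderW cD'; rewrite /n leq_max leq_maxr orbT.
have mA' := cA'.1; have mD' := cD'.1.
have [r [rd rE]] := rotation_mix CS0 mn.
(* Only the first [m] basis vectors are tested, so the right angles beyond them do no harm. *)
have Vr : V r^-1%g.
  apply: mV => i im; rewrite -[X in `|X|]/(r (l2_delta R i) - l2_delta R i) rd//.
  apply: le_lt_trans CSm; apply: le_trans (ler_normD _ _) _.
  by rewrite !normrZ; apply: lerD; rewrite ler_piMr// l2_norm_delta.
have Er := act_mix mn rE cA' cD'.
have sA := measurable_symdiff mA mA'; have sD := measurable_symdiff mD mD'.
have [[_ _ _ pact] _] := gact.
(* Two errors e/4 arise here, in passing from the cylinders to [A] and [D] under the action; two
   more arise below, under [mix]. *)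
have h1 : (mu (A' `&` act r^-1%g @^-1` D') <= (e / 4)%:E + (e / 4)%:E)%E.
  apply: le_trans (leeD AA' DD'); rewrite -(pact r^-1%g _ sD).
  have mG := measurable_act r^-1%g mD; have mG' := measurable_act r^-1%g mD'.
  have mS := measurable_act r^-1%g sD.
  apply: (@le_trans _ _ (mu (A `&` act r^-1%g @^-1` D) +
      mu (symdiff A A' `|` act r^-1%g @^-1` symdiff D D')))%E.
    apply: le_measureU2; [exact: measurableI|exact: measurableI|exact: measurableU|].
    move=> x [A'x D'x]; have [Ax|nAx] := pselect (A x); last by right; left; right.
    have [Dx|nDx] := pselect (D (act r^-1%g x)); first by left.
    by right; right; right.
  by rewrite (nV _ Vr) add0e; exact: measureU2.
have -> : e = (e / 4 + e / 4) + (e / 4 + e / 4) by field.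
rewrite !EFinD; apply: le_trans (leeD h1 (leeD AA' DD')).
rewrite -(fstE _ sA) -(gaussian_mix m CS0 sD) Er.
apply: le_trans (leeD (lexx _) (measureU2 _ _ _)); [|exact: mfst|exact: mmix].
apply: le_measureU2; [exact: mset|exact: mset|apply: measurableU; [exact: mfst|exact: mmix]|].
move=> p [Ap Dp]; have [A'p|nA'p] := pselect (A' p.1); last by right; left; left.
have [D'p|nD'p] := pselect (D' (mix m C0 S0 p)); first by left.
by right; right; left.
Qed.

End gaussian_action.

(** * Transfer to a spatial model and contradiction *)

Lemma normal_prob_unit_interval (R : realType) :
  normal_prob (0 : R) 1 `[0, 1]%classic != 0%E /\
  normal_prob (0 : R) 1 (~` `[0, 1]%classic) != 0%E.
Proof.
have leb1 (a b : R) : b - a = 1 -> lebesgue_measure (`[a, b]%classic : set R) = 1%E.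
  move=> ab; rewrite lebesgue_measure_itv /= lte_fin -subr_gt0 ab ltr01.
  by rewrite -EFinD ab.
split; apply/eqP => /normal_prob_null h.
  by have := h (measurable_itv _); rewrite leb1 ?subr0// => /eqP; rewrite onee_eq0.
have /h N0 : measurable (~` (`[0, 1]%classic : set R)) by apply: measurableC.
(* The complement contains the interval from 2 to 3, of length 1. *)
have : (lebesgue_measure (`[2%R, 3%R]%classic : set R) <= 0)%E.
  rewrite -N0; apply: le_measure; rewrite ?inE//; first exact: measurableC.
  by move=> x /=; rewrite !in_itv /= => /andP[x2 _] /andP[_ /(le_trans x2)]; rewrite (ler_nat R 2 1).
by rewrite leb1 ?lee_fin ?ler10//; ring.
Qed.

(** Each intersection involves a single [g], so the dependence of the null set on [g] is
    harmless. *)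
Lemma whirly_isomorphic (R : realType) (G : topGroupType) d (X : measurableType d)
    (mu : probability X R) (a : G -> X -> X) d' (Y : measurableType d')
    (nu : probability Y R) (b : G -> Y -> Y) (phi : X -> Y) :
  (forall g, measurable_fun [set: X] (a g)) ->
  (forall g, measurable_fun [set: Y] (b g)) ->
  isomorphic_mod0 mu nu phi ->
  (forall g, {ae mu, forall x, phi (a g x) = b g (phi x)}) ->
  whirly mu a -> whirly nu b.
Proof.
move=> ma mb [mphi phiE _] phiab wa V A D V1 mA mD nA nD.
have mpre B : measurable B -> measurable (phi @^-1` B).
  by move=> mB; rewrite -[X in measurable X]setTI; exact: mphi.
rewrite -(phiE _ mA) in nA; rewrite -(phiE _ mD) in nD.
have [g Vg nAD] := wa _ _ _ V1 (mpre _ mA) (mpre _ mD) nA nD; exists g => //.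
have mbD : measurable (b g @^-1` D) by rewrite -[X in measurable X]setTI; exact: mb.
have mapD : measurable (a g @^-1` (phi @^-1` D)).
  by rewrite -[X in measurable X]setTI; apply: ma => //; exact: mpre.
rewrite -phiE; last exact: measurableI.
rewrite -(@measure_ae_eq _ _ _ mu (phi @^-1` A `&` a g @^-1` (phi @^-1` D)))//.
- by apply: measurableI => //; exact: mpre.
- by apply: mpre; exact: measurableI.
- by apply: filterS (phiab g) => x /= ->.
Qed.

Theorem corollary1p8 (R : realType) (gamma_oo : probability (Rinfty R) R)
    (Hgamma : is_gaussian_product gamma_oo)
    (act : Ol2 R -> Rinfty R -> Rinfty R)
    (Hact : gaussian_near_action gamma_oo act) :
  ~ has_spatial_model gamma_oo act.
Proof.
move=> [d [Y [nu [b [[sY mb b1 bM nub] [phi [iso phib]]]]]]].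
have mact g : measurable_fun [set: Rinfty R] (act g).
  by move=> _ F mF; rewrite setTI; exact: (measurable_act Hact).
have mbg g : measurable_fun [set: Y] (b g).
  have mg : measurable_fun setT (fun y => (g : borel (Ol2 R), y) : borel (Ol2 R) * Y).
    exact: pair1_measurable.
  exact: (measurableT_comp mb mg).
have wb : whirly nu b.
  exact: whirly_isomorphic mact mbg iso phib (gaussian_whirly Hgamma Hact).
have [mphi phiE [psi [mpsi psiK _]]] := iso.
(* An event of probability strictly between 0 and 1, to be carried to [Y] by [psi] against the
   zero-one law. *)
pose E : set (Rinfty R) := [set x | `[0, 1]%classic (x 0%N)].
have mE : measurable E.
  rewrite -[X in measurable X]setTI; exact: measurable_coord (measurable_itv _).
have mpre F : measurable F -> measurable (psi @^-1` F).
  by move=> mF; rewrite -[X in measurable X]setTI; exact: mpsi.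
have nuE F : measurable F -> nu (psi @^-1` F) = gamma_oo F.
  move=> mF; rewrite -phiE; last exact: mpre.
  apply: measure_ae_eq => //.
    by rewrite -[X in measurable X]setTI; apply: mphi => //; exact: mpre.
  by apply: filterS psiK => x /= ->.
have [n1 n2] := normal_prob_unit_interval R.
have [|] := whirly_zero_one (@basis_Ol2_basis R) (@Ol2_baire R) mb b1 bM nub wb sY (mpre _ mE).
  by rewrite nuE// (gaussian_coord Hgamma)//; exact/eqP.
rewrite preimage_setC nuE; last exact: measurableC.
rewrite -[X in gamma_oo X]/((fun x : Rinfty R => x 0%N) @^-1` (~` `[0, 1]%classic)).
by rewrite (gaussian_coord Hgamma); [exact/eqP|apply: measurableC].
Qed.
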